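(* Let $(Q,W)$ be the quiver with potential associated to a geometrically consistent brane tiling with bipartite graph $G$, let $A=\mathbb{C}Q/(\partial W)$, $\alpha=(1,\dots,1)\in\mathbb{Z}^{Q_0}$, let $\theta\in B$ be $\alpha$-generic, and let $\mathcal{M}_\theta=\mathcal{M}_\theta(A,\alpha)$. Let $x\in\mathcal{M}_\theta$ be a $T_M$-fixed point and let $$(a_{i,1},\dots,a_{i,2k_i+1}),\qquad i=1,2,3,$$ be the chains of edges connecting the two trivalent vertices of the big component of the cosupport $I_x$. Then there are precisely three $2$-dimensional $T_M$-orbits in $\mathcal{M}_\theta$ containing $x$ in their closures. The corresponding perfect matchings (the cosupports of these orbits) are, for $i=1,2,3$, $$I_x\setminus\{a_{j,2k+1}\mid 0\le k\le k_j,\ j\ne i\}\setminus\{a_{i,2k}\mid 1\le k\le k_i\}.$$ These are the only perfect matchings contained in $I_x$, and $I_x$ is the union of these perfect matchings.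
   Context: Brane tilings. A brane tiling is a bipartite graph $G=(G_0^\pm,G_1)$ (white vertices $G_0^+$, black vertices $G_0^-$) embedded in the real two-dimensional torus $T$ so that all connected components of $T\setminus G$ are simply connected; the set of these faces is $G_2$. The dual quiver $Q=(Q_0,Q_1)$ has $Q_0=G_2$ and $Q_1=G_1$; the arrow $a$ joins the two faces of $G$ adjacent to the edge $a$ and is directed so that the white endpoint lies on the right of $a$. $Q$ is embedded in $T$ and its set of faces $Q_2$ is identified with $G_0$, $Q_2=Q_2^+\sqcup Q_2^-$. The arrows around every face $F\in Q_2$ form an oriented cycle $w_F$. Put $W=\sum_{F\in Q_2^+}w_F-\sum_{F\in Q_2^-}w_F$; for a cycle $u=a_1\cdots a_n$, $\partial u/\partial a=\sum_{i:\,a_i=a}a_{i+1}\cdots a_na_1\cdots a_{i-1}$; $(\partial W)$ is the two-sided ideal generated by all $\partial W/\partial a$, and $A=\mathbb{C}Q/(\partial W)$. Geometric consistency: there is a map $R:Q_1\to(0,1)$ with $\sum_{a\in F}R_a=2$ for all $F\in Q_2$ and $\sum_{a\ni i}(1-R_a)=2$ for all $i\in Q_0$ (sum over arrows incident to $i$, loops counted twice). Groups. $d_2(F)=\sum_{a\in F}a\in\mathbb{Z}^{Q_1}$ for $F\in Q_2$, $d_1(a)=t(a)-s(a)\in\mathbb{Z}^{Q_0}$ for $a\in Q_1$, $\Lambda=\mathbb{Z}^{Q_1}/\langle d_2(F)-d_2(F')\mid F,F'\in Q_2\rangle$, $d:\Lambda\to\mathbb{Z}^{Q_0}$ is induced by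 $d_1$, $M=\ker d$ (free of rank 3), $B=\ker(\mathbb{Z}^{Q_0}\to\mathbb{Z},\ i\mapsto1)=\operatorname{im}d$. For a lattice $L$ put $T_L=\operatorname{Hom}_{\mathbb{Z}}(L,\mathbb{C}^* )$; $T_M=T_\Lambda/T_B$. Moduli. $R(A,\alpha)\subset\mathbb{C}^{Q_1}$ is the variety of representations $x=(x_a)_{a\in Q_1}$ of $Q$ of dimension $\alpha$ satisfying the relations of $W$; $T_\Lambda\subset(\mathbb{C}^* )^{Q_1}$ acts on it by coordinatewise multiplication, and $T_B$ acts via $d$, i.e. by change of basis. $\theta\in B$ is $\alpha$-generic if $\theta\cdot\beta\ne0$ for all $0<\beta<\alpha$ in $\mathbb{Z}^{Q_0}$. $X\in R(A,\alpha)$ is $\theta$-semistable (resp. stable) if $\theta\cdot\dim Y\ge0$ (resp. $>0$) for all proper nonzero subrepresentations $Y\subset X$. $\mathcal{M}_\theta=R(A,\alpha)/\!/_\theta T_B$ is the moduli space of $\theta$-semistable left $A$-modules of dimension $\alpha$; it carries an action of $T_M$. Cosupports. For $x\in\mathcal{M}_\theta$ its cosupport is $I_x=\{a\in Q_1\mid x_a=0\}$, regarded as a subgraph of $G$ via $Q_1=G_1$; it is constant on $T_M$-orbits. A connected component of $I_x$ is big if it has more than one edge; there is at most one. For a $T_M$-fixed point $x$ the big component of $I_x$ exists and has exactly two trivalent vertices, one white and one black, and all its other vertices have valence 2; so it consists of three chains of edges joining the two trivalent vertices, each having an odd number $2k_i+1$ of edges ($k_i\ge0$); $a_{i,1},\dots,a_{i,2k_i+1}$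 are the consecutive edges of the $i$-th chain, with $a_{i,1}$ incident with the white trivalent vertex. The cosupport of every 2-dimensional orbit is a perfect matching (a set of edges of $G$ such that every vertex of $G$ is incident with exactly one of them). *)

(* Defs.v *)
From HB Require Import structures.
From mathcomp Require Import all_boot all_order all_fingroup all_algebra.
From mathcomp Require Import boolp classical_sets reals.
From mathcomp Require Import complex.
From mathcomp Require mpoly.

Set Implicit Arguments.
Unset Strict Implicit.
Unset Printing Implicit Defensive.

Import Order.TTheory GRing.Theory Num.Theory.
Local Open Scope ring_scope.

(** * Brane tilings *)

(* A bipartite graph on an oriented closed surface whose complement is a union
   of open discs is given, up to homeomorphism, by its finite set of edges and
   the two permutations sending an edge to the next one counterclockwise around
   its white, resp. black, endpoint.  White vertices, black vertices and faces
   are the cycles of [rotw], [rotb] and [rotw * rotb] (first [rotw], then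
   [rotb]).  Transitivity says that the surface is connected (and that there is
   an edge); the equation #vertices - #edges + #faces = 0 says that it is a
   torus. *)
Record brane_tiling := BraneTiling {
  edge :> finType;
  rotw : {perm edge};
  rotb : {perm edge};
  rot_transitive :
    [transitive <<[set rotw; rotb]>>, on [set: edge] | 'P]%g;
  euler_torus :
    (#|porbits rotw| + #|porbits rotb| + #|porbits (rotw * rotb)%g| = #|edge|)%N
}.

Section Tiling.
Variable G : brane_tiling.

(* A vertex of the graph, i.e. a face of the dual quiver, is represented by the
   set of its edges.  A white and a black vertex may have the same set of edges,
   hence the two separate predicates. *)
Definition white_vertices : {set {set G}} := porbits (rotw G).
Definition black_vertices : {set {set G}} := porbits (rotb G).

Definition is_quiver_face (F : {set G}) : bool :=
  (F \in white_vertices) || (F \in black_vertices).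

(** ** The dual quiver and its potential *)

Definition facerot : {perm G} := (rotw G * rotb G)%g.

Definition Q0 : Type := {i : {set G} | i \in porbits facerot}.
HB.instance Definition _ := Finite.on Q0.

Lemma mem_porbits (s : {perm G}) (a : G) : porbit s a \in porbits s.
Proof. exact: imset_f. Qed.

Definition face_at (a : G) : Q0 :=
  exist _ (porbit facerot a) (mem_porbits facerot a).

(* With its white endpoint on its right, an arrow [a] turns clockwise around
   this endpoint and counterclockwise around its black one, so that it is
   followed by [(rotw G)^-1 a] in the cycle of the white endpoint and by
   [rotb G a] in the cycle of the black one.  These two arrows lie in the same
   cycle of [facerot], whose elements are the arrows leaving a given face. *)
Definition src (a : G) : Q0 := face_at a.
Definition tgt (a : G) : Q0 := face_at (rotb G a).

(* The cycle [w_F] of a face [F] around which the arrows follow one another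
   according to [s], written from an arbitrary arrow of [F]. *)
Definition face_cycle (s : {perm G}) (F : {set G}) : seq G :=
  if [pick a in F] is Some a then traject s a #|F| else [::].

(* The paths a_(i+1) ... a_n a_1 ... a_(i-1), for all i with a_i = a. *)
Definition cycle_derivative (u : seq G) (a : G) : seq (seq G) :=
  [seq behead (rot i u) | i <- iota 0 (size u) & nth a u i == a].

Definition geometrically_consistent (R : realType) : Prop :=
  exists r : G -> R,
    [/\ forall a, 0 < r a < 1,
        forall F, is_quiver_face F -> \sum_(a in F) r a = 2
      & forall i : Q0, \sum_(a | src a == i) (1 - r a)
                       + \sum_(a | tgt a == i) (1 - r a) = 2].

(** ** Lattices *)

Definition d2 (F : {set G}) : {ffun G -> int} := [ffun a => (a \in F)%:Z].
Definition d1 (a : G) : {ffun Q0 -> int} :=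
  [ffun i => (i == tgt a)%:Z - (i == src a)%:Z].

Definition in_B (theta : {ffun Q0 -> int}) : Prop := \sum_i theta i = 0.

Definition pairing (theta beta : {ffun Q0 -> int}) : int :=
  \sum_i theta i * beta i.

Definition alpha : {ffun Q0 -> int} := [ffun=> 1].

Definition alpha_generic (theta : {ffun Q0 -> int}) : Prop :=
  forall beta : {ffun Q0 -> int},
    (forall i, 0 <= beta i <= alpha i) -> beta != 0 -> beta != alpha ->
    pairing theta beta != 0.

(** ** Perfect matchings and subgraphs (given by their sets of edges) *)

Definition perfect_matching (P : {set G}) : Prop :=
  forall v, is_quiver_face v -> #|v :&: P| = 1%N.

Definition edge_adjacent (I : {set G}) : rel G := [rel a b |
  [&& a \in I, b \in I &
      (porbit (rotw G) a == porbit (rotw G) b)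
      || (porbit (rotb G) a == porbit (rotb G) b)]].

Definition component (I : {set G}) (a : G) : {set G} :=
  [set b | connect (edge_adjacent I) a b]%SET.

Definition big_component (I C : {set G}) : Prop :=
  (exists2 a, a \in I & C = component I a) /\ (1 < #|C|)%N.

(* [vw] and [vb] are the only trivalent vertices of the subgraph [C], all its
   other vertices being bivalent.  As the graph is bipartite, an edge is never a
   loop, and the valence of [v] in [C] is [#|v :&: C|]. *)
Definition trivalent_vertices (C vw vb : {set G}) : Prop :=
  [/\ vw \in white_vertices /\ #|vw :&: C| = 3%N,
      vb \in black_vertices /\ #|vb :&: C| = 3%N,
      forall v, v \in white_vertices -> v != vw -> v :&: C != finset.set0 ->
        #|v :&: C| = 2%N
    & forall v, v \in black_vertices -> v != vb -> v :&: C != finset.set0 ->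
        #|v :&: C| = 2%N].

(* (a i 1, ..., a i (2 k_i + 1)), for i in 'I_3, are the three chains of edges
   connecting the two trivalent vertices of [C], starting from the white one.
   The other values of [a i] are irrelevant. *)
Definition connecting_chains
    (C : {set G}) (k : 'I_3 -> nat) (a : 'I_3 -> nat -> G) : Prop :=
  exists vw vb : {set G},
    [/\ trivalent_vertices C vw vb,
        forall i, a i 1%N \in vw /\ a i (k i).*2.+1 \in vb,
        forall i j, (0 < j < (k i).*2.+1)%N ->
          if odd j then porbit (rotb G) (a i j) = porbit (rotb G) (a i j.+1)
          else porbit (rotw G) (a i j) = porbit (rotw G) (a i j.+1),
        forall i i' j j', (0 < j <= (k i).*2.+1)%N ->
          (0 < j' <= (k i').*2.+1)%N -> a i j = a i' j' -> i = i' /\ j = j'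
      & forall b, b \in C <-> exists i j, (0 < j <= (k i).*2.+1)%N /\ b = a i j].

Definition chain_matching
    (I : {set G}) (k : 'I_3 -> nat) (a : 'I_3 -> nat -> G) (i : 'I_3)
    : {set G} :=
  (I :\: \bigcup_(j | j != i) [set a j (val l).*2.+1 | l : 'I_(k j).+1]
     :\: [set a i (val l).*2 | l : 'I_(k i).+1 & (0 < val l)%N])%SET.

(** * Moduli spaces *)

Section Moduli.
Variable R : realType.
Local Notation C := R[i].

(* The affine space C^(Q_1) of representations of dimension [alpha]. *)
Definition rep : Type := {ffun G -> C}.

Definition path_eval (x : rep) (p : seq G) : C := \prod_(b <- p) x b.

(* The value at [x] of dW/da. *)
Definition potential_derivative (x : rep) (a : G) : C :=
  \sum_(F in white_vertices)
     \sum_(p <- cycle_derivative (face_cycle (rotw G)^-1%g F) a) path_eval x p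
  - \sum_(F in black_vertices)
     \sum_(p <- cycle_derivative (face_cycle (rotb G) F) a) path_eval x p.

Definition in_repA (x : rep) : Prop := forall a, potential_derivative x a = 0.

(* Each space of the representation is the line C. *)
Definition subrep (x : rep) (Y : Q0 -> {vspace C^o}) : Prop :=
  forall (a : G) (v : C^o), v \in Y (src a) -> (x a * v : C^o) \in Y (tgt a).

Definition dimv (Y : Q0 -> {vspace C^o}) : {ffun Q0 -> int} :=
  [ffun i => (\dim (Y i))%:Z].

Definition semistable (theta : {ffun Q0 -> int}) (x : rep) : Prop :=
  forall Y, subrep x Y ->
    (exists i, Y i != 0%VS) -> (exists i, Y i != fullv) ->
    0 <= pairing theta (dimv Y).

Definition cosupport (x : rep) : {set G} := [set a | x a == 0]%SET.

(** ** Tori *)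

(* The value on [v] of the character of Z^I with values [t] on the basis. *)
Definition char_eval (I : finType) (t : {ffun I -> C}) (v : {ffun I -> int}) :
  C := \prod_i t i ^ v i.

(* Hom(Lambda, C^* ), as the characters of Z^(Q_1) which are trivial on the
   generators of the subgroup defining Lambda. *)
Definition T_Lambda : set rep := [set t : rep |
  (forall a, t a != 0)
  /\ forall F F', is_quiver_face F -> is_quiver_face F' ->
       char_eval t (d2 F - d2 F') = 1]%classic.

(* The image in [T_Lambda] of Hom(B, C^* ); as B is a direct summand of Z^(Q_0),
   the characters of B are the restrictions of those of Z^(Q_0). *)
Definition T_B : set rep :=
  [set t : rep | exists g : {ffun Q0 -> C},
     (forall i, g i != 0) /\ t = [ffun a => char_eval g (d1 a)]]%classic.

Definition tmul (t x : rep) : rep := [ffun a => t a * x a].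

(** ** The GIT quotient *)

Definition zariski_closed (Z : set rep) : Prop :=
  exists S : set (mpoly.mpoly #|G| C),
    Z = [set x : rep |
          forall p, S p -> mpoly.meval (fun j => x (enum_val j)) p = 0]%classic.

Section Quotient.
Variable theta : {ffun Q0 -> int}.

Definition Rss : set rep := [set x | in_repA x /\ semistable theta x]%classic.

Definition T_B_orbit_closure (x : rep) : set rep :=
  smallest zariski_closed [set tmul t x | t in T_B]%classic.

(* [M_theta] is the good quotient of [Rss] by [T_B]: its points are the classes
   of points of [Rss] whose orbit closures in [Rss] meet, and it carries the
   quotient of the Zariski topology. *)
Definition git_class (x : rep) : set rep :=
  (Rss `&` [set y |
     Rss `&` T_B_orbit_closure x `&` T_B_orbit_closure y !=set0])%classic.

Definition M_theta : set (set rep) := [set git_class x | x in Rss]%classic.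

Definition M_closed (Z : set (set rep)) : Prop :=
  (Z `<=` M_theta)%classic /\
  exists2 V, zariski_closed V & forall x, Rss x -> (Z (git_class x) <-> V x).

Definition M_closure (O : set (set rep)) : set (set rep) := smallest M_closed O.

(* The action of an element of T_M = T_Lambda / T_B, given by a representative
   [t], on a point of [M_theta]. *)
Definition M_act (t : rep) (p : set rep) : set rep :=
  [set tmul t y | y in p]%classic.

Definition T_M_orbit (p : set rep) : set (set rep) :=
  [set M_act t p | t in T_Lambda]%classic.

Definition T_M_fixed (p : set rep) : Prop :=
  forall t, T_Lambda t -> M_act t p = p.

Definition is_T_M_orbit (O : set (set rep)) : Prop :=
  exists2 p, M_theta p & O = T_M_orbit p.

(* Krull dimension, in the topology induced from [M_theta]. *)
Definition irreducible (Z : set (set rep)) : Prop :=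
  (Z !=set0)%classic /\
  forall Z1 Z2, M_closed Z1 -> M_closed Z2 -> (Z `<=` Z1 `|` Z2)%classic ->
    (Z `<=` Z1)%classic \/ (Z `<=` Z2)%classic.

Definition irreducible_chain (O : set (set rep)) (n : nat) : Prop :=
  exists Z : nat -> set (set rep),
    [/\ forall i, (i <= n)%N ->
          exists2 Z', M_closed Z' & Z i = (O `&` Z')%classic,
        forall i, (i <= n)%N -> irreducible (Z i)
      & forall i, (i < n)%N -> (Z i `<` Z i.+1)%classic].

Definition has_dimension (O : set (set rep)) (n : nat) : Prop :=
  irreducible_chain O n /\ ~ irreducible_chain O n.+1.

Definition orbit_cosupport (O : set (set rep)) (P : {set G}) : Prop :=
  forall p y, O p -> p y -> cosupport y = P.

End Quotient.
End Moduli.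
End Tiling.

(* Main.v *)
Require Import Defs.
From mathcomp Require Import all_boot all_order all_fingroup all_algebra.
From mathcomp Require Import boolp classical_sets reals.
From mathcomp Require Import complex.
From mathcomp Require Import mpoly zify ring.

(* Let I be the cosupport of x and D its big component.  Since theta is generic,
   the dual quiver stays connected when the arrows of I are deleted.  Hence the
   cycles supported in I inject into the homology of the torus, which has rank
   2; as the three chains already contribute 2, all components of I other than
   D are single edges.  Let P_1, P_2, P_3 be the three alternating matchings.

   As x is fixed, the torus T_Lambda acts on the support of x through T_B, so
   T_Lambda is the product of T_B and of the one-parameter subgroups of the P_i
   (s acts by s on the edges of P_i and trivially elsewhere).  Let y be a point
   whose orbit has x in its closure; its cosupport J is contained in I, and the
   orbit is parametrized by the coordinates s_i such that P_i is not contained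
   in J.  The inverse coordinates are the values at y of the cycles made of the
   first edge of the i-th chain and of a walk outside I.  So the orbit is a torus
   whose dimension is the number of such i, and it is 2 exactly when J = P_i.
   There is just one orbit with cosupport P_i, obtained from a point z of the
   open orbit that agrees with x outside I, by setting to 0 the coordinates of
   z in P_i. *)

Set Implicit Arguments.
Unset Strict Implicit.
Unset Printing Implicit Defensive.

Import Order.TTheory GRing.Theory Num.Theory.
Local Open Scope ring_scope.

(** * Length of chains of irreducible closed sets *)

(** Dimension is defined by chains of irreducible closed sets in the quotient topology, so an orbit
    has to be compared with a torus as a topological space, and chains in a torus have to be bounded
    directly. The bound comes from algebraic dependence: polynomials separating the members of a
    chain are algebraically independent, and more than [r] polynomials in [r] variables never are.
    In the comparison, the inverse coordinates are quotients of monomials; numerator and denominator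
    need not be invariant under [T_B], but they have the same character, so equations in the
    coordinates are homogenized before they are read on representations. The homology of the torus
    appears only as a rank inequality between rational matrices, whose constant 2 comes from the
    Euler relation and from the connectedness of [G] and of the dual quiver outside [J]. The
    relations of the potential enter through a property of subgraphs, [saturated], which makes
    membership propagate along a chain. *)

Section AlgebraicDimension.
Variables (K : fieldType) (r : nat).
Implicit Types (Z : set ('I_r -> K)) (p q : {mpoly K[r]}).

Definition poly_irreducible Z :=
  (exists s, Z s) /\
  forall p q, (forall s, Z s -> p.@[s] * q.@[s] = 0) ->
    (forall s, Z s -> p.@[s] = 0) \/ (forall s, Z s -> q.@[s] = 0).

Lemma poly_irreducible_exp Z p q n s0 : poly_irreducible Z ->
  Z s0 -> p.@[s0] != 0 ->
  (forall s, Z s -> p.@[s] ^+ n * q.@[s] = 0) -> forall s, Z s -> q.@[s] = 0.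
Proof.
move=> [_ irr] Zs0 ps0 H.
case: (irr (p ^+ n) q) => // [s Zs|H'].
  by rewrite rmorphXn /= H.
by have /eqP := H' _ Zs0; rewrite rmorphXn /= expf_eq0 (negPf ps0) andbF.
Qed.

(* The element of [A] with the least exponent of [f n] survives on [Z n], once
   that power of [f n] has been cancelled on the irreducible set [Z n.+1]. *)
Lemma chain_alg_independent (Z : nat -> set ('I_r -> K))
    (f : nat -> {mpoly K[r]}) n :
  (forall i, (i <= n)%N -> poly_irreducible (Z i)) ->
  (forall i, (i < n)%N -> forall s, Z i s -> Z i.+1 s /\ (f i).@[s] = 0) ->
  (forall i, (i < n)%N -> exists2 s, Z i.+1 s & (f i).@[s] != 0) ->
  forall (J : finType) (A : {set J}) (e : J -> nat -> nat) (c : J -> K),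
    A != finset.set0 -> (forall j, j \in A -> c j != 0) ->
    {in A &, forall j j', (forall i, (i < n)%N -> e j i = e j' i) -> j = j'} ->
    exists2 s, Z n s &
      (\sum_(j in A) c j *: \prod_(i < n) f i ^+ e j i).@[s] != 0.
Proof.
elim: n => [|n IHn] irr sub nz J A e c A0 cA eA.
  have [[s Zs] _] := irr 0%N isT.
  have [j jA] := set0Pn _ A0.
  have -> : A = [set j]%SET.
    apply/setP => j'; rewrite inE; apply/idP/eqP => [j'A|->//].
    exact: eA.
  exists s => //; rewrite big_set1 big_ord0 mevalZ meval1 mulr1.
  exact: cA.
have [j0 j0A] := set0Pn _ A0.
pose jm := [arg min_(j < j0 in A) e j n].
have [jmA jmin] : jm \in A /\ forall j, j \in A -> (e jm n <= e j n)%N.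
  by rewrite /jm; case: arg_minnP => // j' j'A H; split.
pose m := e jm n.
pose A' := [set j in A | e j n == m]%SET.
have A'0 : A' != finset.set0 by apply/set0Pn; exists jm; rewrite inE jmA eqxx.
have irr' i : (i <= n)%N -> poly_irreducible (Z i).
  by move=> Hi; apply: irr; apply: leqW.
have sub' i : (i < n)%N -> forall s, Z i s -> Z i.+1 s /\ (f i).@[s] = 0.
  by move=> Hi; apply: sub; apply: leqW.
have nz' i : (i < n)%N -> exists2 s, Z i.+1 s & (f i).@[s] != 0.
  by move=> Hi; apply: nz; apply: leqW.
have [||s Zs Hs] := IHn irr' sub' nz' J A' e c A'0.
- by move=> j; rewrite inE => /andP[/cA].
- move=> j j'; rewrite !inE => /andP[jA /eqP ej] /andP[j'A /eqP ej'] H.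
  apply: eA => // i; rewrite ltnS leq_eqVlt => /orP[/eqP->|/H//].
  by rewrite ej.
apply: contrapT => Hno.
have [Zs' fs] := sub n (ltnSn n) s Zs.
pose q := \sum_(j in A) c j *: ((\prod_(i < n) f i ^+ e j i)
            * f n ^+ (e j n - m)).
have qE : \sum_(j in A) c j *: (\prod_(i < n.+1) f i ^+ e j i) = f n ^+ m * q.
  rewrite /q mulr_sumr; apply: eq_bigr => j jA.
  rewrite -scalerAr mulrCA -exprD subnKC; last exact: jmin.
  by rewrite big_ord_recr.
have [s0 Zs0 fs0] := nz n (ltnSn n).
have q0 : q.@[s] = 0.
  apply: (poly_irreducible_exp (irr n.+1 _) Zs0 fs0 (n := m)) => // s1 Zs1.
  apply/eqP; apply/negPn/negP => H; apply: Hno; exists s1 => //.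
  by rewrite qE mevalM rmorphXn.
(* As [f n] vanishes at [s], the terms outside [A'], whose exponent exceeds [m], drop out of [q]
   there. *)
case/negP: Hs; apply/eqP; rewrite -q0 /q !raddf_sum /=.
rewrite [RHS](big_setID A') /= [X in _ = _ + X]big1 ?addr0; last first.
  move=> j; rewrite !inE => /andP[]; case jA: (j \in A) => //= ejm _.
  rewrite mevalZ mevalM rmorphXn /= fs expr0n subn_eq0.
  by rewrite leqNgt ltn_neqAle eq_sym ejm jmin //= !mulr0.
have -> : A :&: A' = A'.
  by apply/finset.setIidPr/fintype.subsetP => j; rewrite inE => /andP[].
apply: eq_bigr => j; rewrite inE => /andP[_ /eqP->].
by rewrite subnn expr0 mulr1.
Qed.

Lemma msizeM_bound p q a b :
  (msize p <= a.+1 -> msize q <= b.+1 -> msize (p * q)%R <= (a + b).+1)%N.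
Proof.
have [->|p0] := eqVneq p 0; first by rewrite mul0r msize0.
have [->|q0] := eqVneq q 0; first by rewrite mulr0 msize0.
rewrite msizeM //; move: (msize p) (msize q) => u v; lia.
Qed.

Lemma msize_prod_exp n (f : nat -> {mpoly K[r]}) (e : nat -> nat) D d :
  (forall i, (i < n)%N -> msize (f i) <= D.+1)%N ->
  (forall i, (i < n)%N -> e i <= d)%N ->
  (msize (\prod_(i < n) f i ^+ e i)%R <= (n * (d * D)).+1)%N.
Proof.
elim: n => [|n IHn] fD ed; first by rewrite big_ord0 msize1.
rewrite big_ord_recr /= mulSn addnC; apply: msizeM_bound.
  by apply: IHn => i Hi; [apply: fD | apply: ed]; apply: leqW.
apply: (@leq_trans ((e n) * D).+1); last first.
  by rewrite ltnS leq_mul2r ed ?orbT.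
elim: (e n) => [|k IHk]; first by rewrite expr0 msize1.
by rewrite exprS mulSn; apply: msizeM_bound => //; apply: fD.
Qed.

(** By counting: there are [d.+1 ^ n] products with exponents at most [d], and they lie in the span
    of [N.+1 ^ r] monomials, which are fewer for large [d] because [r < n]. *)
Lemma mpoly_dependent n (f : nat -> {mpoly K[r]}) : (r < n)%N ->
  exists d (c : {ffun 'I_n -> 'I_d.+1} -> K),
    (exists e, c e != 0) /\
    \sum_e c e *: (\prod_(i < n) f i ^+ e i) = 0.
Proof.
move=> rn.
pose D := \max_(i < n) msize (f i).
(* With this choice [N.+1 ^ r <= ((n * D).+1 * d.+1) ^ r = d * d.+1 ^ r < d.+1 ^ r.+1]. *)
pose d := ((n * D).+1 ^ r)%N.
pose N := (n * (d * D))%N.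
pose J := {ffun 'I_n -> 'I_d.+1}; pose E := {ffun 'I_r -> 'I_N.+1}.
pose prd (e : J) := \prod_(i < n) f i ^+ e i.
pose mon (e : E) : 'X_{1.. r} := [multinom val (e i) | i < r].
have prd_size e : (msize (prd e) <= N.+1)%N.
  rewrite /prd.
  have -> : \prod_(i < n) f i ^+ e i =
      \prod_(i < n) f i ^+ (if insub (val i) is Some j then val (e j) else 0%N).
    by apply: eq_bigr => i _; rewrite valK.
  apply: (@msize_prod_exp n f
    (fun i => if insub i is Some j then val (e j) else 0%N)) => i Hi.
    rewrite (leq_trans _ (leqnSn _)) //.
    exact: (leq_bigmax (Ordinal Hi)).
  by case: insubP => // j _ _; rewrite -ltnS; exact: ltn_ord.
pose M : 'M[K]_(#|J|, #|E|) :=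
  \matrix_(j, e) (prd (enum_val j))@_(mon (enum_val e)).
have cardlt : (#|E| < #|J|)%N.
  rewrite !card_ffun !card_ord.
  apply: (@leq_trans (d.+1 ^ r.+1)); last by rewrite leq_pexp2l.
  rewrite expnS.
  have H : (N.+1 <= (n * D).+1 * d.+1)%N by rewrite /N; nia.
  apply: (@leq_ltn_trans (((n * D).+1 * d.+1) ^ r)); first by case: (r) => // r0; rewrite leq_exp2r.
  by rewrite expnMn ltn_mul2r expn_gt0 /= ltnS.
have [v v0 vM] : exists2 v : 'rV_#|J|, v != 0 & v *m M = 0.
  have : kermx M != 0.
    rewrite -mxrank_eq0 mxrank_ker subn_eq0 -ltnNge.
    exact: leq_ltn_trans (rank_leq_col _) cardlt.
  by move=> /rowV0Pn[v /sub_kermxP vM v0]; exists v.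
exists d, (fun e => v 0 (enum_rank e)); split.
  have /rV0Pn[j vj] := v0.
  by exists (enum_val j); rewrite enum_valK.
apply/mpolyP => m; rewrite mcoeff0 raddf_sum /=.
under eq_bigr => e _ do rewrite mcoeffZ -/(prd e).
have [mN|mN] := boolP [forall i, (m i < N.+1)%N]; last first.
  apply: big1 => e _; rewrite memN_msupp_eq0 ?mulr0 //.
  apply: contra mN => /msize_mdeg_lt mlt; apply/forallP => i.
  apply: leq_trans (prd_size e); apply: leq_ltn_trans mlt.
  by rewrite mdegE (bigD1 i) //= leq_addr.
pose em : E := [ffun i => Ordinal (forallP mN i)].
have -> : m = mon em by apply/mnmP => i; rewrite mnmE ffunE.
have := congr1 (fun u : 'rV_#|E| => u 0 (enum_rank em)) vM.
rewrite !mxE => H0; rewrite -[RHS]H0 (reindex (fun j : 'I_#|J| => enum_val j)) /=.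
  by apply: eq_bigr => j _; rewrite !mxE !enum_rankK enum_valK.
by exists (@enum_rank J) => x _; rewrite ?enum_valK ?enum_rankK.
Qed.

(** Polynomials that vanish on [Z i] but not on [Z i.+1] are algebraically independent, so there are
    at most [r] of them. *)
Lemma poly_chain_length (Z : nat -> set ('I_r -> K)) n :
  (forall i, (i <= n)%N -> poly_irreducible (Z i)) ->
  (forall i, (i < n)%N -> forall s, Z i s -> Z i.+1 s) ->
  (forall i, (i < n)%N -> exists f : {mpoly K[r]},
     (forall s, Z i s -> f.@[s] = 0) /\ (exists2 s, Z i.+1 s & f.@[s] != 0)) ->
  (n <= r)%N.
Proof.
move=> irr sub fex; rewrite leqNgt; apply/negP => rn.
pose f i := if pselect (exists f : {mpoly K[r]},
     (forall s, Z i s -> f.@[s] = 0) /\ (exists2 s, Z i.+1 s & f.@[s] != 0))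
  is left H then projT1 (cid H) else 0.
have fP i : (i < n)%N -> (forall s, Z i s -> (f i).@[s] = 0)
    /\ (exists2 s, Z i.+1 s & (f i).@[s] != 0).
  by move=> Hi; rewrite /f; case: pselect => [H|/(_ (fex i Hi))//]; case: cid.
have [d [c [[e0 ce0] Hc]]] := mpoly_dependent f rn.
pose A := [set e | c e != 0]%SET.
have sub' i : (i < n)%N -> forall s, Z i s -> Z i.+1 s /\ (f i).@[s] = 0.
  by move=> Hi s Zs; split; [exact: sub | have [+ _] := fP i Hi; exact].
have [|j|e e' _ _ H|s _] := chain_alg_independent irr sub' (fun i Hi => (fP i Hi).2)
  (A := A) (e := fun (e : {ffun 'I_n -> 'I_d.+1}) i =>
          if insub i is Some j then val (e j) else 0%N) (c := c).
- by apply/set0Pn; exists e0; rewrite inE.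
- by rewrite inE.
- apply/ffunP => i; apply/val_inj.
  by have := H i (ltn_ord i); rewrite valK.
rewrite (_ : \sum_(j in A) _ = 0) ?meval0 ?eqxx // -[RHS]Hc.
rewrite [RHS](bigID (fun e => e \in A)) /= [X in _ = _ + X]big1 ?addr0 => [|e].
  by apply: eq_bigr => e _; congr (_ *: _); apply: eq_bigr => i _; rewrite valK.
by rewrite inE negbK => /eqP->; rewrite scale0r.
Qed.

End AlgebraicDimension.

(** * Coordinate subtori *)

Section Subtori.
Variables (K : numFieldType) (r : nat).

Lemma poly_all_roots (P : {poly K}) : (forall u, P.[u] = 0) -> P = 0.
Proof.
move=> H; apply/eqP/negPn/negP => P0.
have := @max_poly_roots _ P [seq i%:R | i <- iota 0 (size P)] P0.
rewrite size_map size_iota ltnn => /(_ _ _)/notF; apply.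
  by apply/allP => u _; rewrite /root H.
rewrite map_inj_uniq ?iota_uniq // => i j /eqP.
by rewrite eqr_nat => /eqP.
Qed.

Lemma horner_mmap n (p : {mpoly K[n]}) (c : 'I_n -> {poly K}) u :
  (mmap polyC c p).[u] = p.@[fun i => (c i).[u]].
Proof.
rewrite mevalE /mmap horner_sum; apply: eq_bigr => m _.
rewrite hornerM hornerC /mmap1 horner_prod; congr (_ * _).
by apply: eq_bigr => i _; rewrite horner_exp.
Qed.

Lemma mpoly_on_line (p : {mpoly K[r]}) (s1 s2 : 'I_r -> K) :
  exists P : {poly K}, forall u, P.[u] = p.@[fun i => s1 i + u * (s2 i - s1 i)].
Proof.
exists (mmap polyC (fun i => (s1 i)%:P + 'X * (s2 i - s1 i)%:P) p) => u.
by rewrite horner_mmap; apply: meval_eq => i; rewrite !hornerE.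
Qed.

Definition torus : set ('I_r -> K) := [set s | forall i, s i != 0]%classic.

(** The subtori for [k] from 0 to [r] are the members of a chain of length [r] in the torus. *)
Definition subtorus (k : nat) : set ('I_r -> K) :=
  [set s | torus s /\ forall i : 'I_r, (k <= i)%N -> s i = 1]%classic.

(* On the line joining a point where p does not vanish to a point where q does
   not, the product of p, q and the coordinates is a nonzero polynomial. *)
Lemma subtorus_irreducible k : poly_irreducible (subtorus k).
Proof.
split; first by exists (fun=> 1); split=> [i|//]; rewrite oner_neq0.
move=> p q pq0.
have [|] := pselect (forall s, subtorus k s -> p.@[s] = 0); first by left.
move=> /existsNP[s1 /not_implyP[Ws1 /eqP ps1]]; right => s2 Ws2.
apply/eqP/negPn/negP => qs2.
have [P PE] := mpoly_on_line p s1 s2; have [Q QE] := mpoly_on_line q s1 s2.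
have [T TE] := mpoly_on_line (\prod_i 'X_i) s1 s2.
have TE' u : T.[u] = \prod_i (s1 i + u * (s2 i - s1 i)).
  by rewrite TE rmorph_prod; apply: eq_bigr => i _; rewrite /= mevalXU.
have P0 : P != 0.
  apply: contra ps1 => /eqP P0; have := PE 0; rewrite P0 horner0 => H.
  by apply/eqP; rewrite [RHS]H; apply: meval_eq => i; rewrite mul0r addr0.
have Q0 : Q != 0.
  apply: contra qs2 => /eqP Q0; have := QE 1; rewrite Q0 horner0 => H.
  by apply/eqP; rewrite [RHS]H; apply: meval_eq => i; rewrite mul1r addrCA subrr addr0.
have T0 : T != 0.
  apply/eqP => T0; have := TE' 0; rewrite T0 horner0 => /esym/eqP.
  rewrite prodf_seq_eq0 => /hasP[i _ /=].
  by rewrite mul0r addr0 (negPf (Ws1.1 i)).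
have : T * (P * Q) = 0.
  apply: poly_all_roots => u; rewrite !hornerM.
  have [->|Tu] := eqVneq T.[u] 0; first by rewrite mul0r.
  rewrite PE QE pq0 ?mulr0 //; split => [i|i ki].
    move: Tu; rewrite TE' prodf_seq_neq0 => /allP/(_ i); apply.
    by rewrite mem_index_enum.
  by rewrite Ws1.2 // Ws2.2 // subrr mulr0 addr0.
by move/eqP; rewrite !mulf_eq0 (negPf T0) (negPf P0) (negPf Q0).
Qed.

End Subtori.

(** * Dimension of a space with a torus chart *)

Section OrbitDimension.
Variables (G : brane_tiling) (R : realType) (theta : {ffun Q0 G -> int}).
Local Notation C := R[i].
Variables (O : set (set (rep G R))) (r : nat) (phi : ('I_r -> C) -> set (rep G R)).

Hypothesis phi_onto : forall p, O p <-> exists2 s, torus s & p = phi s.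
Hypothesis phi_continuous : forall Z, M_closed theta Z ->
  exists S : set {mpoly C[r]},
    forall s, torus s -> (Z (phi s) <-> forall q, S q -> q.@[s] = 0).
Hypothesis phi_closed : forall S : set {mpoly C[r]},
  exists2 Z, M_closed theta Z &
    forall s, torus s -> (Z (phi s) <-> forall q, S q -> q.@[s] = 0).

(** The chain is pulled back by [phi]: [phi_closed] turns a vanishing product of polynomials into a
    cover by two closed sets, and [phi_continuous] provides the separating polynomials. *)
Lemma torus_chain_length n : irreducible_chain theta O n -> (n <= r)%N.
Proof.
case=> Z [Zcl Zirr Zlt].
have ZO i p : (i <= n)%N -> Z i p -> O p.
  by move=> /Zcl[Z' _ ->] [].
pose W i : set ('I_r -> C) := [set s | torus s /\ Z i (phi s)]%classic.
apply: (@poly_chain_length _ _ W) => [i Hi|i Hi s [ts Zs]|i Hi].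
- have [[p Zp] irr] := Zirr i Hi; split.
    have /phi_onto[s ts ps] := ZO _ _ Hi Zp.
    by exists s; split => //; rewrite -ps.
  move=> p1 p2 H.
  have [Z1 Z1cl Z1E] := phi_closed [set p1].
  have [Z2 Z2cl Z2E] := phi_closed [set p2].
  have [|H1|H2] := irr Z1 Z2 Z1cl Z2cl.
  + move=> x Zx; have /phi_onto[s ts xE] := ZO _ _ Hi Zx.
    have := H s; rewrite /W /= -xE => /(_ (conj ts Zx))/eqP.
    rewrite mulf_eq0 xE => /orP[/eqP H'|/eqP H'].
      by left; apply/Z1E => // q ->.
    by right; apply/Z2E => // q ->.
  + by left => s [ts /H1 /(Z1E _ ts)]; apply.
  + by right => s [ts /H2 /(Z2E _ ts)]; apply.
- by split => //; have [+ _] := Zlt i Hi; apply.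
have [sub /existsNP[p /not_implyP[Zp Zp']]] := Zlt i Hi.
have [Z' Z'cl ZE] := Zcl i (ltnW Hi).
have [S SE] := phi_continuous Z'cl.
have Op := ZO _ _ Hi Zp; have /phi_onto[s ts pE] := Op.
have Zp1 : ~ Z' p by move=> H; apply: Zp'; rewrite ZE.
have /existsNP[f /not_implyP[Sf fs]] : ~ forall q, S q -> q.@[s] = 0.
  by move/(SE s ts); rewrite -pE.
exists f; split; last first.
  by exists s; [split => //; rewrite -pE | apply/eqP].
by move=> s' [ts']; rewrite ZE => -[_ /(SE _ ts')]; apply.
Qed.

Lemma torus_chain : irreducible_chain theta O r.
Proof.
pose Z k := [set phi s | s in subtorus k]%classic : set (set (rep G R)).
pose S k : set {mpoly C[r]} :=
  [set q | exists2 i : 'I_r, (k <= i)%N & q = 'X_i - 1]%classic.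
have SE k s : torus s -> ((forall q, S k q -> q.@[s] = 0) <-> subtorus k s).
  move=> ts; split=> [H|[_ H] q [i ki ->]].
    split => // i ki; have := H ('X_i - 1).
    rewrite mevalB mevalXU meval1 => /(_ _)/eqP; rewrite subr_eq0 => H1.
    by apply/eqP; apply: H1; exists i.
  by rewrite mevalB mevalXU meval1 H // subrr.
(* Injectivity of [phi] is replaced by [phi_closed]: a closed set cut out by [S k] depends only on
   the point [phi s]. *)
have ZE k s : torus s -> (Z k (phi s) <-> subtorus k s).
  move=> ts; split; last by exists s.
  have [Z' _ Z'E] := phi_closed (S k).
  case=> s' Ws' E; have ts' := Ws'.1; apply/SE => //; apply/Z'E => //.
  by rewrite -E; apply/Z'E => //; apply/SE.
exists Z; split => [k _|k _|k kr].
- have [Z' Z'cl Z'E] := phi_closed (S k); exists Z' => //.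
  apply/seteqP; split=> [_ [s Ws <-]|p [/phi_onto[s ts ->]]].
    have ts := Ws.1; split; first by apply/phi_onto; exists s.
    by apply/Z'E => //; apply/SE.
  by move/(Z'E _ ts)/(SE _ _ ts) => Ws; exists s.
- have [[s Ws] irr] := @subtorus_irreducible C r k; split.
    by exists (phi s); exists s.
  move=> Z1 Z2 /phi_continuous[S1 S1E] /phi_continuous[S2 S2E] cov.
  have [|] := pselect (Z k `<=` Z1)%classic; first by left.
  move=> /existsNP[_ /not_implyP[[s1 Ws1 <-] nZ1]]; right => _ [s2 Ws2 <-].
  apply/S2E => [|q Sq]; first exact: Ws2.1.
  have /existsNP[p /not_implyP[Sp ps1]] : ~ forall q, S1 q -> q.@[s1] = 0.
    by move/S1E => H; apply: nZ1; apply: H; exact: Ws1.1.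
  have [s' Ws'|H|H] := irr p q; [|by have := H _ Ws1|exact: H].
  have ts' := Ws'.1.
  have [/(S1E _ ts') H|/(S2E _ ts') H] := cov (phi s') (imageP _ Ws').
    by rewrite (H p) // mul0r.
  by rewrite (H q) // mulr0.
- split=> [_ [s [ts Ws] <-]|].
    by exists s => //; split => // i ki; apply: Ws; apply: ltnW.
  (* Any coordinate other than 0 and 1 in place [k] gives a point of [subtorus k.+1] outside
     [subtorus k]. *)
  pose s (i : 'I_r) : C := if i == k :> nat then 2 else 1.
  have ts : torus s.
    by move=> i; rewrite /s; case: ifP; rewrite ?pnatr_eq0 ?oner_neq0.
  move=> /(_ (phi s)) H.
  have /H/(ZE k s ts)[_ /(_ (Ordinal kr) (leqnn _))] : Z k.+1 (phi s).
    apply/ZE => //; split => // i ki; rewrite /s ifN //.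
    by rewrite neq_ltn ki orbT.
  rewrite /s /= eqxx => /eqP; rewrite -subr_eq0 -[2]/(1 + 1 : C) addrK.
  by rewrite oner_eq0.
Qed.

End OrbitDimension.

(** * Representations and tori *)

Section Permutations.
Variables (T : finType) (s : {perm T}).

Lemma porbit_step a : porbit s (s a) = porbit s a.
Proof. exact: (porbit_perm s 1 a). Qed.

Lemma mem_porbits_eq v a : v \in porbits s -> a \in v -> v = porbit s a.
Proof. by case/imsetP=> b _ -> ab; apply/esym/eqP; rewrite eq_porbit_mem. Qed.

Lemma porbitsV : porbits s^-1%g = porbits s.
Proof. exact: (eq_imset _ (porbitV s)). Qed.

Lemma big_porbit_step (R : Type) (idx : R) (op : Monoid.com_law idx)
    (F : T -> R) v : v \in porbits s ->
  \big[op/idx]_(a in v) F (s a) = \big[op/idx]_(a in v) F a.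
Proof.
case/imsetP=> b _ ->; rewrite [RHS](reindex_inj (@perm_inj _ s)) /=.
by apply: eq_bigl => a; rewrite -!eq_porbit_mem porbit_step.
Qed.

End Permutations.

Section Tiling.
Variable G : brane_tiling.
Local Notation wv := (porbit (rotw G)).
Local Notation bv := (porbit (rotb G)).

Lemma quiver_faceP (v : {set G}) :
  reflect (exists a, v = wv a \/ v = bv a) (is_quiver_face v).
Proof.
apply: (iffP orP) => [[/imsetP[a _ ->]|/imsetP[a _ ->]]|[a [->|->]]].
- by exists a; left.
- by exists a; right.
- by left; apply: imset_f.
- by right; apply: imset_f.
Qed.

Lemma wv_face a : is_quiver_face (wv a).
Proof. by apply/quiver_faceP; exists a; left. Qed.

Lemma bv_face a : is_quiver_face (bv a).
Proof. by apply/quiver_faceP; exists a; right. Qed.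

Lemma rot_closed_setT (A : {set G}) a : a \in A ->
  (forall c, c \in A -> rotw G c \in A) ->
  (forall c, c \in A -> rotb G c \in A) -> A = [set: G]%SET.
Proof.
move=> aA Aw Ab.
have acts : [acts <<[set rotw G; rotb G]>>, on A | 'P]%g.
  rewrite gen_subG finset.subUset !finset.sub1set !inE /=.
  by apply/andP; split; apply/fintype.subsetP => c cA; rewrite inE /= apermE;
    [apply: Aw | apply: Ab].
apply/eqP; rewrite finset.eqEsubset finset.subsetT /=.
have := acts_sub_orbit a acts; rewrite aA.
by rewrite (atransP (rot_transitive G)) ?inE // => ->.
Qed.

Lemma rot_invariant_const (T : eqType) (f : G -> T) :
  (forall a, f (rotw G a) = f a) -> (forall a, f (rotb G a) = f a) ->
  forall a b, f a = f b.
Proof.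
move=> fw fb a b.
have /setP/(_ a) : [set c | f c == f b]%SET = [set: G]%SET.
  apply: (rot_closed_setT (a := b)) => [|c|c]; rewrite !inE ?eqxx //.
    by rewrite fw.
  by rewrite fb.
by rewrite !inE => /eqP.
Qed.

Lemma face_cycle_perm (s : {perm G}) F :
  F \in porbits s -> perm_eq (face_cycle s F) (enum F).
Proof.
move=> Fs; rewrite /face_cycle; case: pickP => [a aF|F0]; last first.
  by move: Fs; case/imsetP => b _ FE; have := F0 b; rewrite FE porbit_id.
rewrite (mem_porbits_eq Fs aF); apply: uniq_perm.
- exact: uniq_traject_porbit.
- exact: enum_uniq.
by move=> b; rewrite mem_enum porbit_traject.
Qed.

Lemma cycle_derivative_uniq (u : seq G) a : uniq u ->
  exists2 ps, cycle_derivative u a = (if a \in u then [:: ps] else [::]) &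
    a \in u -> perm_eq ps (rem a u).
Proof.
move=> uu; rewrite /cycle_derivative.
have -> : [seq i <- iota 0 (size u) | nth a u i == a] =
    if a \in u then [:: index a u] else [::].
  case: ifP => au; last first.
    apply/eqP; rewrite -(negbK (_ == _)) -has_filter; apply/hasPn => i.
    rewrite mem_iota add0n /= => iu; apply: contraFneq au => <-.
    exact: mem_nth.
  have iu : (index a u < size u)%N by rewrite index_mem.
  rewrite (eq_in_filter (a2 := pred1 (index a u))) => [|i].
    by rewrite filter_pred1_uniq ?iota_uniq // mem_iota.
  rewrite mem_iota add0n /= => iu'; apply/eqP/eqP => [H|->].
    by rewrite -[in RHS]H index_uniq.
  exact: nth_index.
exists (behead (rot (index a u) u)); first by case: ifP.
move=> au; rewrite -(perm_cons a) rot_index //=.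
apply: (@perm_trans _ u); last exact: perm_to_rem.
by rewrite -rot_index // perm_rot perm_refl.
Qed.

Variable R : realType.
Local Notation C := R[i].
Implicit Types (x y z t : rep G R) (v F J : {set G}).

Lemma path_eval_derivative x (s : {perm G}) F a : F \in porbits s ->
  \sum_(p <- cycle_derivative (face_cycle s F) a) path_eval x p =
  if a \in F then \prod_(b in F :\ a) x b else 0.
Proof.
move=> Fs; have PE := face_cycle_perm Fs.
have uu : uniq (face_cycle s F) by rewrite (perm_uniq PE) enum_uniq.
have mE b : (b \in face_cycle s F) = (b \in F) by rewrite (perm_mem PE) mem_enum.
have [ps -> Hps] := cycle_derivative_uniq a uu.
rewrite mE; case: ifP => aF; last by rewrite big_nil.
rewrite big_seq1 /path_eval (perm_big _ (Hps _)) /=; last by rewrite mE.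
rewrite rem_filter // big_filter [in RHS]big_mkcond -[in RHS]big_filter.
transitivity (\prod_(b <- enum F | b != a) x b).
  by rewrite (perm_big _ PE).
rewrite [LHS]big_enum_cond /=.
by rewrite big_filter -big_mkcond; apply: eq_bigl => b; rewrite !inE andbC.
Qed.

(** Every arrow occurs once in the cycle of one white and of one black vertex, so the derivative is
    a difference of two monomials. *)
Lemma potential_derivativeE x a : potential_derivative x a =
  \prod_(b in wv a :\ a) x b - \prod_(b in bv a :\ a) x b.
Proof.
rewrite /potential_derivative; congr (_ - _).
  rewrite (bigD1 (wv a)) /=; last exact: imset_f.
  rewrite path_eval_derivative ?porbit_id; last first.
    by rewrite porbitsV; exact: imset_f.
  rewrite [X in _ + X]big1 ?addr0 // => F /andP[Fw Fa].
  rewrite path_eval_derivative; last by rewrite porbitsV.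
  by rewrite ifN //; apply: contra Fa => aF; rewrite (mem_porbits_eq Fw aF).
rewrite (bigD1 (bv a)) /=; last exact: imset_f.
rewrite path_eval_derivative ?porbit_id; last exact: imset_f.
rewrite [X in _ + X]big1 ?addr0 // => F /andP[Fw Fa]; rewrite path_eval_derivative //.
by rewrite ifN //; apply: contra Fa => aF; rewrite (mem_porbits_eq Fw aF).
Qed.

Lemma in_repAP x : in_repA x <->
  forall a, \prod_(b in wv a :\ a) x b = \prod_(b in bv a :\ a) x b.
Proof.
split=> H a; have := H a; rewrite potential_derivativeE.
  by move/eqP; rewrite subr_eq0 => /eqP.
by move=> ->; rewrite subrr.
Qed.

Definition equal_products x :=
  forall F F', is_quiver_face F -> is_quiver_face F' ->
    \prod_(b in F) x b = \prod_(b in F') x b.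

(** Multiplying the relation at [a] by [x a] equates the full products at the two ends of [a];
    connectedness of [G] spreads this to all vertices. *)
Lemma repA_equal_products x : in_repA x -> equal_products x.
Proof.
move/in_repAP => H.
have wb a : \prod_(b in wv a) x b = \prod_(b in bv a) x b.
  rewrite (big_setD1 a) ?porbit_id //= (big_setD1 (A := bv a) a) ?porbit_id //=.
  by rewrite H.
have cst := @rot_invariant_const _ (fun a => \prod_(b in wv a) x b).
have {}cst a b : \prod_(c in wv a) x c = \prod_(c in wv b) x c.
  by apply: cst => c; [rewrite porbit_step | rewrite !wb porbit_step].
by move=> F F' /quiver_faceP[a [->|->]] /quiver_faceP[b [->|->]]; rewrite -?wb.
Qed.

Lemma T_LambdaP t :
  T_Lambda t <-> (forall a, t a != 0) /\ equal_products t.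
Proof.
have E v : (forall a, t a != 0) -> \prod_a t a ^ d2 v a = \prod_(a in v) t a.
  move=> t0; rewrite [RHS]big_mkcond; apply: eq_bigr => a _.
  by rewrite ffunE; case: (a \in v).
suff E2 F F' : (forall a, t a != 0) ->
    (char_eval t (d2 F - d2 F') = 1 <->
     \prod_(b in F) t b = \prod_(b in F') t b).
  split=> -[t0 H]; split=> // F F' HF HF'; apply/E2 => //; exact: H.
move=> t0; rewrite /char_eval.
have -> : \prod_i t i ^ (d2 F - d2 F') i =
    (\prod_(b in F) t b) / (\prod_(b in F') t b).
  rewrite -!E // -prodf_div; apply: eq_bigr => a _.
  by rewrite [(_ - _ : {ffun _ -> _}) a]ffunE [(- _ : {ffun _ -> _}) a]ffunE expfzDr // invr_expz.
have nz : \prod_(b in F') t b != 0 by apply/prodf_neq0.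
split=> [|->]; last by rewrite divff.
by move=> H; exact: divr1_eq.
Qed.

Definition gauge (g : {ffun Q0 G -> C}) : rep G R :=
  [ffun a => g (tgt a) / g (src a)].

Lemma T_BP t :
  T_B t <-> exists2 g : {ffun Q0 G -> C}, (forall i, g i != 0) & t = gauge g.
Proof.
suff E (g : {ffun Q0 G -> C}) : (forall i, g i != 0) ->
    [ffun a => char_eval g (d1 a)] = gauge g.
  split=> [[g [g0 ->]]|[g g0 ->]]; exists g => //; first exact: E.
  by split => //; rewrite E.
have E1 i : \prod_j g j ^ (j == i)%:Z = g i.
  rewrite (bigD1 i) //= eqxx big1 ?mulr1 // => j /negPf ->.
  by rewrite expr0z.
move=> g0; apply/ffunP => a; rewrite !ffunE /char_eval -(E1 (tgt a)).
rewrite -(E1 (src a)) -prodf_div; apply: eq_bigr => i _.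
by rewrite ffunE expfzDr // invr_expz.
Qed.

Lemma gauge_neq0 (g : {ffun Q0 G -> C}) a : (forall i, g i != 0) -> gauge g a != 0.
Proof. by move=> g0; rewrite ffunE mulf_neq0 ?invr_eq0. Qed.

Lemma src_rotw_inv a : src ((rotw G)^-1%g a) = tgt a.
Proof.
rewrite /src /tgt /face_at; apply: val_inj => /=.
by rewrite -[LHS]porbit_step /facerot permM permKV.
Qed.

(** Around a face the target of each arrow is the source of the next, so the product telescopes. *)
Lemma prod_gauge (g : {ffun Q0 G -> C}) F : (forall i, g i != 0) -> is_quiver_face F ->
  \prod_(a in F) gauge g a = 1.
Proof.
move=> g0 HF; under eq_bigr => a _ do rewrite ffunE.
rewrite prodf_div.
suff -> : \prod_(a in F) g (tgt a) = \prod_(a in F) g (src a).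
  by rewrite divff //; apply/prodf_neq0.
case/orP: HF => HF; last first.
  exact: (big_porbit_step _ (fun a => g (src a))).
under eq_bigr => a _ do rewrite -src_rotw_inv.
apply: (big_porbit_step _ (fun a => g (src a))).
by rewrite porbitsV.
Qed.

Lemma T_B_sub_T_Lambda t : T_B t -> T_Lambda t.
Proof.
move/T_BP=> [g g0 ->]; apply/T_LambdaP; split; first by move=> a; exact: gauge_neq0.
by move=> F F' HF HF'; rewrite !prod_gauge.
Qed.

(** Both sides of the relation at [a] are scaled by the common face product of [t] divided by
    [t a]. *)
Lemma T_Lambda_repA t x : T_Lambda t -> in_repA x -> in_repA (tmul t x).
Proof.
move/T_LambdaP => [t0 tF] /in_repAP H; apply/in_repAP => a.
have E v : a \in v -> \prod_(b in v :\ a) tmul t x b =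
    (\prod_(b in v) t b) / t a * \prod_(b in v :\ a) x b.
  move=> av; under eq_bigr => b _ do rewrite ffunE.
  by rewrite big_split /= (big_setD1 a av) /= [t a * _]mulrC mulfK.
by rewrite !E ?porbit_id // H (tF _ _ (wv_face a) (bv_face a)).
Qed.

Lemma tmulA t t' x : tmul (tmul t t') x = tmul t (tmul t' x).
Proof. by apply/ffunP => a; rewrite !ffunE mulrA. Qed.

Lemma tmulC t t' : tmul t t' = tmul t' t.
Proof. by apply/ffunP => a; rewrite !ffunE mulrC. Qed.

Lemma T_Lambda_mul t t' : T_Lambda t -> T_Lambda t' -> T_Lambda (tmul t t').
Proof.
move/T_LambdaP => [t0 tF] /T_LambdaP[t'0 t'F]; apply/T_LambdaP; split.
  by move=> a; rewrite ffunE mulf_neq0.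
move=> F F' HF HF'; under eq_bigr => b _ do rewrite ffunE.
under [RHS]eq_bigr => b _ do rewrite ffunE.
by rewrite !big_split /= (tF F F') // (t'F F F').
Qed.

Definition tinv t : rep G R := [ffun a => (t a)^-1].

Lemma tmulK t x : (forall a, t a != 0) -> tmul (tinv t) (tmul t x) = x.
Proof. by move=> t0; apply/ffunP => a; rewrite !ffunE mulKf. Qed.

Lemma T_Lambda_inv t : T_Lambda t -> T_Lambda (tinv t).
Proof.
move/T_LambdaP => [t0 tF]; apply/T_LambdaP; split.
  by move=> a; rewrite ffunE invr_eq0.
move=> F F' HF HF'; under eq_bigr => b _ do rewrite ffunE.
under [RHS]eq_bigr => b _ do rewrite ffunE.
by rewrite !prodfV (tF F F').
Qed.

Lemma T_B_mul t t' : T_B t -> T_B t' -> T_B (tmul t t').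
Proof.
move/T_BP=> [g g0 ->] /T_BP[g' g'0 ->]; apply/T_BP.
exists [ffun i => g i * g' i] => [i|].
  by rewrite ffunE mulf_neq0.
by apply/ffunP => a; rewrite !ffunE invfM mulrACA.
Qed.

Lemma T_B_inv t : T_B t -> T_B (tinv t).
Proof.
move/T_BP=> [g g0 ->]; apply/T_BP; exists [ffun i => (g i)^-1] => [i|].
  by rewrite ffunE invr_eq0.
by apply/ffunP => a; rewrite !ffunE invfM.
Qed.

Lemma T_Lambda_neq0 t a : T_Lambda t -> t a != 0.
Proof. by move/T_LambdaP => -[]. Qed.

Lemma cosupport_tmul t x : T_Lambda t -> cosupport (tmul t x) = cosupport x.
Proof.
move=> tL; apply/setP => a.
by rewrite !inE ffunE mulf_eq0 (negPf (T_Lambda_neq0 a tL)).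
Qed.

(** Each [x a] is a multiple of [y a], so every subrepresentation of [y] is one of [x]. *)
Lemma semistable_cosupport theta x y : cosupport y \subset cosupport x ->
  semistable theta x -> semistable theta y.
Proof.
move=> sub ss Y subY; apply: ss => a u uY.
have [->|xa] := eqVneq (x a) 0; first by rewrite mul0r mem0v.
have ya : y a != 0.
  by apply: contra xa => ya; have := fintype.subsetP sub a; rewrite !inE => ->.
have -> : x a * u = (x a / y a) *: (y a * u : C^o).
  by rewrite /GRing.scale /= mulrA divfK.
by apply: memvZ; apply: subY.
Qed.

Lemma T_Lambda_Rss theta t x : T_Lambda t -> Rss theta x -> Rss theta (tmul t x).
Proof.
move=> tL [xA xss]; split; first exact: T_Lambda_repA.
by apply: semistable_cosupport xss; rewrite cosupport_tmul.
Qed.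

End Tiling.

(** * Connectivity and the points of the quotient *)

Section Connectivity.
Variable G : brane_tiling.
Implicit Type J : {set G}.

(* The dual quiver remains connected when the arrows of [J] are deleted. *)
Definition dual_connected J := forall A : {set Q0 G}, A != finset.set0 ->
  (forall a, a \notin J -> (src a \in A) = (tgt a \in A)) -> A = [set: Q0 G]%SET.

Lemma edge_inhabited : exists a : G, True.
Proof. by have /imsetP[a _ _] := rot_transitive G; exists a. Qed.

Variable R : realType.
Local Notation C := R[i].
Implicit Types (x y z t : rep G R) (g : {ffun Q0 G -> C}) (m n : G -> nat).

(** A union of components of the remaining dual quiver and its complement both support
    subrepresentations. Their pairings with [theta] are nonnegative and add up to 0, hence vanish,
    against genericity. *)
Lemma stable_connected theta x : in_B theta -> alpha_generic theta ->
  semistable theta x -> dual_connected (cosupport x).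
Proof.
move=> thB gen ss A /set0Pn[i0 i0A] Acl; apply/eqP/negPn/negP => AT.
have [i1 i1A] : exists i, i \notin A.
  apply/existsP; apply: contraNT AT; rewrite negb_exists => /forallP H.
  by apply/eqP/setP => i; rewrite inE; have := H i; rewrite negbK.
pose Y (B : {set Q0 G}) (i : Q0 G) : {vspace C^o} :=
  if i \in B then fullv else 0%VS.
have dimY B : Defs.dimv (Y B) = [ffun i => (i \in B)%:Z].
  apply/ffunP => i; rewrite !ffunE /Y.
  by case: ifP; rewrite ?dimv0 // dimvf.
have full0 : (fullv : {vspace C^o}) != 0%VS by rewrite -dimv_eq0 dimvf.
have subY (B : {set Q0 G}) :
    (forall a, a \notin cosupport x -> (src a \in B) = (tgt a \in B)) ->
    subrep x (Y B).
  move=> Bcl a u; rewrite /Y.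
  have [xa|xa] := eqVneq (x a) 0; first by rewrite xa mul0r mem0v.
  rewrite Bcl ?inE //; case: ifP => _; first by move=> _; exact: memvf.
  by rewrite !memv0 => /eqP ->; rewrite mulr0.
have ge0 (B : {set Q0 G}) i j : i \in B -> j \notin B ->
    (forall a, a \notin cosupport x -> (src a \in B) = (tgt a \in B)) ->
    0 <= \sum_i theta i * (i \in B)%:Z.
  move=> iB jB Bcl; have := ss _ (subY _ Bcl).
  rewrite dimY /pairing => H.
  under eq_bigr => l _ do rewrite -(ffunE (fun i => (i \in B)%:Z)).
  apply: H; first by exists i; rewrite /Y iB.
  by exists j; rewrite /Y (negPf jB) eq_sym.
have geA := ge0 A _ _ i0A i1A Acl.
have geB := ge0 (~: A) i1 i0.
rewrite !inE i1A i0A in geB; have {geB} := geB isT isT.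
have H a : a \notin cosupport x -> (src a \in ~: A) = (tgt a \in ~: A).
  by move=> aJ; rewrite !inE Acl.
move=> /(_ H) geB.
have sumE : \sum_i theta i * (i \in A)%:Z + \sum_i theta i * (i \in ~: A)%:Z = 0.
  rewrite -big_split /= -[RHS]thB; apply: eq_bigr => i _.
  by rewrite inE; case: (i \in A); rewrite /= ?mulr1 ?mulr0 ?addr0 ?add0r.
have := gen (Defs.dimv (Y A)); rewrite dimY => /(_ _ _ _)/negP; apply.
- by move=> i; rewrite !ffunE; case: (i \in A).
- by apply/eqP => /ffunP/(_ i0); rewrite !ffunE i0A.
- by apply/eqP => /ffunP/(_ i1); rewrite !ffunE (negPf i1A).
rewrite /pairing; under eq_bigr => i _ do rewrite ffunE.
rewrite eq_le geA andbT.
by rewrite -[leRHS]sumE lerDl.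
Qed.

(** Exponents are natural numbers, so that monomials make sense where coordinates vanish; an element
    of Z^(Q_1) is encoded by a pair [m], [n] standing for their difference. *)
Definition monomial y m : C := \prod_a y a ^+ m a.

Definition expD m n : G -> nat := fun a => (m a + n a)%N.

Lemma monomialD y m n : monomial y (expD m n) = monomial y m * monomial y n.
Proof. by rewrite -big_split; apply: eq_bigr => a _; rewrite exprD. Qed.

Lemma monomial1 y a : monomial y (fun b => (b == a) : nat) = y a.
Proof.
rewrite /monomial (bigD1 a) //= eqxx big1 ?mulr1 // => b /negPf ->.
by rewrite expr0.
Qed.

Lemma monomial_tmul t y m : monomial (tmul t y) m = monomial t m * monomial y m.
Proof. by rewrite -big_split; apply: eq_bigr => a _; rewrite ffunE exprMn. Qed.

Definition supported_off J m := forall a, a \in J -> m a = 0%N.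

Lemma monomial_neq0 y m : supported_off (cosupport y) m -> monomial y m != 0.
Proof.
move=> mJ; apply/prodf_neq0 => a _; have [/eqP ya|ya] := boolP (y a == 0).
  by rewrite mJ ?inE ?ya ?eqxx // expr0 oner_neq0.
exact: expf_neq0.
Qed.

(* [m - n] is the sum of the arrows of a walk from [i0] to [i]. *)
Lemma walk J i0 : dual_connected J -> forall i, exists m n,
  [/\ supported_off J m, supported_off J n
    & forall g, (forall i, g i != 0) ->
        monomial (gauge g) m * g i0 = g i * monomial (gauge g) n].
Proof.
move=> con i.
pose P i := exists m n,
  [/\ supported_off J m, supported_off J n
    & forall g, (forall i, g i != 0) ->
        monomial (gauge g) m * g i0 = g i * monomial (gauge g) n].
suff AT : [set i | `[< P i >]]%SET = [set: Q0 G]%SET.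
  by have := finset.in_setT i; rewrite -AT finset.inE => /asboolP.
have stepJ (a : G) m : a \notin J -> supported_off J m ->
    supported_off J (expD m (fun b => (b == a) : nat)).
  move=> aJ mJ b bJ; rewrite /expD mJ //.
  by case: eqP => // ba; rewrite -ba bJ in aJ.
apply: con => [|a aJ].
  apply/set0Pn; exists i0; rewrite inE; apply/asboolP.
  exists (fun=> 0%N), (fun=> 0%N); split => // g _.
  by rewrite mulrC.
rewrite !inE; apply: asbool_equiv_eq; split.
- case=> m [n [mJ nJ H]].
  exists (expD m (fun b => (b == a) : nat)), n; split => // [|g g0].
    exact: stepJ.
  by rewrite monomialD monomial1 ffunE mulrAC H //; field; exact: g0.
- case=> m [n [mJ nJ H]].
  exists m, (expD n (fun b => (b == a) : nat)); split => // [|g g0].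
    exact: stepJ.
  by rewrite H // monomialD monomial1 ffunE; field; exact: g0.
Qed.

(** Expresses that [m - n] is a cycle of the dual quiver, tested on the elements of [T_B]. *)
Definition balanced m n := forall g, (forall i, g i != 0) ->
  monomial (gauge g) m = monomial (gauge g) n.

(** The closed walk goes from [i0] to [src a], along [a], and back from [tgt a] to [i0]; negative
    multiplicities are moved to the right-hand side. *)
Lemma walk_cycle J i0 a (wm wn : Q0 G -> G -> nat) :
  (forall i, [/\ supported_off J (wm i), supported_off J (wn i)
    & forall g, (forall i, g i != 0) ->
        monomial (gauge g) (wm i) * g i0 = g i * monomial (gauge g) (wn i)]) ->
  balanced (expD (fun b => (b == a) : nat) (expD (wm (src a)) (wn (tgt a))))
           (expD (wn (src a)) (wm (tgt a))).
Proof.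
move=> W g g0; rewrite !monomialD monomial1 ffunE.
have [_ _ /(_ _ g0) Hs] := W (src a); have [_ _ /(_ _ g0) Ht] := W (tgt a).
apply: (mulIf (g0 i0)); rewrite -[RHS]mulrA Ht.
rewrite (_ : _ * g i0 = g (tgt a) / g (src a) * (monomial (gauge g) (wm (src a)) * g i0) * monomial (gauge g) (wn (tgt a))); last by ring.
by rewrite Hs; field; exact: g0.
Qed.


Lemma arrow_cycle J a : dual_connected J -> exists m n,
  [/\ supported_off J m, supported_off J n
    & balanced (expD (fun b => (b == a) : nat) m) n].
Proof.
move=> con.
have /choice[wm /choice[wn W]] := walk (src a) con.
have [mJ nJ] : (forall i, supported_off J (wm i)) /\ (forall i, supported_off J (wn i)).
  by split=> i; have [] := W i.
do 2!eexists; split; last exact: (walk_cycle _ W).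
  by move=> b bJ; rewrite /expD mJ ?nJ.
by move=> b bJ; rewrite /expD mJ ?nJ.
Qed.

Definition coord_eval y (p : {mpoly C[#|G|]}) : C :=
  p.@[fun j => y (enum_val j)].

Definition mono_poly m : {mpoly C[#|G|]} := \prod_a 'X_(enum_rank a) ^+ m a.

Lemma mono_polyE y m : coord_eval y (mono_poly m) = monomial y m.
Proof.
rewrite /coord_eval rmorph_prod; apply: eq_bigr => a _.
by rewrite rmorphXn /= mevalXU enum_rankK.
Qed.

Lemma closed_coord_eval (p : {mpoly C[#|G|]}) :
  zariski_closed [set y : rep G R | coord_eval y p = 0]%classic.
Proof.
exists [set p]%classic; apply/seteqP; split => y /= H; first by move=> q ->.
exact: H.
Qed.

Lemma T_B_orbit_closure_eq x (p : {mpoly C[#|G|]}) :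
  (forall t, T_B t -> coord_eval (tmul t x) p = 0) ->
  forall z, T_B_orbit_closure x z -> coord_eval z p = 0.
Proof.
move=> H z /(_ _ (conj (closed_coord_eval p) _)); apply.
by move=> _ [t tB <-]; exact: H.
Qed.

(** On the orbit of [x] both monomials are scaled by the same factor; the cross-multiplied identity
    is polynomial and passes to the closure. *)
Lemma closure_balanced x z m n : T_B_orbit_closure x z -> balanced m n ->
  monomial z m * monomial x n = monomial z n * monomial x m.
Proof.
move=> zx bal; apply/eqP; rewrite -subr_eq0 -!mono_polyE; apply/eqP.
pose p := coord_eval x (mono_poly n) *: mono_poly m
          - coord_eval x (mono_poly m) *: mono_poly n.
have pE y : coord_eval y p = coord_eval y (mono_poly m) * coord_eval x (mono_poly n)
    - coord_eval y (mono_poly n) * coord_eval x (mono_poly m).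
  by rewrite /coord_eval mevalB !mevalZ ![_ * meval (fun j => y _) _]mulrC.
rewrite -pE; apply: T_B_orbit_closure_eq zx => t /T_BP[g g0 ->].
by rewrite pE !mono_polyE !monomial_tmul bal // mulrAC subrr.
Qed.

Lemma closure_cosupport x z :
  T_B_orbit_closure x z -> cosupport x \subset cosupport z.
Proof.
move=> zx; apply/fintype.subsetP => a; rewrite !inE => /eqP xa; apply/eqP.
rewrite -(monomial1 z a) -mono_polyE.
apply: T_B_orbit_closure_eq zx => t _.
by rewrite mono_polyE monomial1 ffunE xa mulr0.
Qed.

(* Going around a cycle formed by an arrow [a] and arrows of the support of
   [z], the balanced monomials determine [z a] from [x a]. *)
Lemma closure_connected x z : T_B_orbit_closure x z ->
  dual_connected (cosupport z) -> exists2 t, T_B t & z = tmul t x.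
Proof.
move=> zx con; have [a0 _] := edge_inhabited.
have /choice[wm /choice[wn W]] := walk (src a0) con.
have sub := fintype.subsetP (closure_cosupport zx).
have nzz m : supported_off (cosupport z) m -> monomial z m != 0 by exact: monomial_neq0.
have nzx m : supported_off (cosupport z) m -> monomial x m != 0.
  by move=> mz; apply: monomial_neq0 => a /sub; exact: mz.
have [Wm Wn] : (forall i, supported_off (cosupport z) (wm i))
    /\ (forall i, supported_off (cosupport z) (wn i)).
  by split=> i; have [] := W i.
(* [g i] compares the values of [z] and of [x] on the walk from [src a0] to [i]. The walk avoids the
   cosupport of [z], hence also that of [x], so nothing vanishes. *)
pose g : {ffun Q0 G -> C} := [ffun i => (monomial z (wm i) * monomial x (wn i))
                   / (monomial z (wn i) * monomial x (wm i))].
have g0 i : g i != 0.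
  by rewrite ffunE mulf_neq0 ?invr_eq0 // mulf_neq0 ?nzz ?nzx.
exists (gauge g); first by apply/T_BP; exists g.
apply/ffunP => a; rewrite !ffunE.
have := closure_balanced zx (walk_cycle a W).
rewrite !monomialD !monomial1.
move: (nzz _ (Wm (src a))) (nzz _ (Wn (src a))) (nzx _ (Wm (src a))) (nzx _ (Wn (src a))).
move: (nzz _ (Wm (tgt a))) (nzz _ (Wn (tgt a))) (nzx _ (Wm (tgt a))) (nzx _ (Wn (tgt a))).
move: (monomial _ _) => zmt; move: (monomial _ _) => znt.
move: (monomial _ _) => xmt; move: (monomial _ _) => xnt.
move: (monomial _ _) => zms; move: (monomial _ _) => zns.
move: (monomial _ _) => xms; move: (monomial _ _) => xns.
move=> zmt0 znt0 xmt0 xnt0 zms0 zns0 xms0 xns0 H.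
have nz : zms * znt * (xns * xmt) != 0 by rewrite !mulf_neq0.
apply: (mulIf nz).
transitivity (z a * (zms * znt) * (xns * xmt)); first by ring.
by rewrite H; field; rewrite zms0 zns0 xms0 xns0 znt0 xmt0.
Qed.

(** * Points of the quotient as orbits of [T_B] *)

Section GIT.
Variable theta : {ffun Q0 G -> int}.
Hypotheses (theta_B : in_B theta) (theta_generic : alpha_generic theta).

Lemma Rss_connected x : Rss theta x -> dual_connected (cosupport x).
Proof. by case=> _; exact: stable_connected. Qed.

Lemma T_B1 : T_B ([ffun=> 1] : rep G R).
Proof.
apply/T_BP; exists [ffun=> 1] => [i|]; first by rewrite ffunE oner_neq0.
by apply/ffunP => a; rewrite !ffunE divr1.
Qed.

Lemma tmul1 x : tmul [ffun=> 1] x = x.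
Proof. by apply/ffunP => a; rewrite !ffunE mul1r. Qed.

Lemma T_B_orbit_in_closure t x : T_B t -> T_B_orbit_closure x (tmul t x).
Proof. by move=> tB Z [_ ZO]; apply: ZO; exists t. Qed.

Lemma T_B_neq0 t : T_B t -> forall a, t a != 0 :> C.
Proof. by move=> tB a; apply/T_Lambda_neq0/T_B_sub_T_Lambda. Qed.

(** A semistable point has connected support, so by [closure_connected] it lies in every orbit whose
    closure contains it; orbits in [Rss] are therefore closed there. *)
Lemma git_classP x y : Rss theta x ->
  git_class theta x y <-> exists2 t, T_B t & y = tmul t x.
Proof.
move=> xs; split=> [[ys [z [[zs zx] zy]]]|[t tB ->]].
  have [t tB zE] := closure_connected zx (Rss_connected zs).
  have [u uB zE'] := closure_connected zy (Rss_connected zs).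
  exists (tmul (tinv u) t); first exact: T_B_mul (T_B_inv uB) tB.
  by rewrite tmulA -zE zE' tmulK //; exact: T_B_neq0.
split; first exact: T_Lambda_Rss (T_B_sub_T_Lambda tB) xs.
exists x; split; first split => //.
  by rewrite -{2}(tmul1 x); apply: T_B_orbit_in_closure T_B1.
rewrite -{2}(tmulK x (T_B_neq0 tB)).
by apply: T_B_orbit_in_closure; exact: T_B_inv.
Qed.

Lemma git_class_eq x y : Rss theta x -> Rss theta y ->
  git_class theta x = git_class theta y <-> exists2 t, T_B t & y = tmul t x.
Proof.
move=> xs ys; rewrite -git_classP //; split=> [->|].
  by apply/git_classP => //; exists [ffun=> 1]; [exact: T_B1 | rewrite tmul1].
move/(git_classP _ xs) => [t tB yE]; apply/seteqP; split=> z.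
  move/(git_classP _ xs) => [u uB ->]; apply/git_classP => //.
  exists (tmul u (tinv t)); first exact: T_B_mul uB (T_B_inv tB).
  by rewrite tmulA yE tmulK //; exact: T_B_neq0.
move/(git_classP _ ys) => [u uB ->]; apply/git_classP => //.
by exists (tmul u t); [exact: T_B_mul | rewrite tmulA yE].
Qed.

Lemma git_class_tmul t x : Rss theta x -> T_B t ->
  git_class theta (tmul t x) = git_class theta x.
Proof.
move=> xs tB; apply/esym/git_class_eq => //; last by exists t.
exact: T_Lambda_Rss (T_B_sub_T_Lambda tB) xs.
Qed.

Lemma M_act_git_class t x : Rss theta x -> T_Lambda t ->
  M_act t (git_class theta x) = git_class theta (tmul t x).
Proof.
move=> xs tL; have txs := T_Lambda_Rss tL xs.
apply/seteqP; split=> [_ [y /(git_classP _ xs)[u uB ->] <-]|z].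
  apply/git_classP => //; exists u => //.
  by rewrite -!tmulA [tmul t u]tmulC.
move/(git_classP _ txs) => [u uB ->]; exists (tmul u x).
  by apply/git_classP => //; exists u.
by rewrite -!tmulA [tmul t u]tmulC.
Qed.

Lemma T_M_orbitP x p : Rss theta x ->
  T_M_orbit (git_class theta x) p <->
  exists2 t, T_Lambda t & p = git_class theta (tmul t x).
Proof.
move=> xs; split=> [[t tL <-]|[t tL ->]]; exists t => //.
  by rewrite M_act_git_class.
by rewrite M_act_git_class.
Qed.

End GIT.
End Connectivity.

(** * Rank of the homology of the torus *)

Section FinTypeMatrices.
Variable K : fieldType.
Implicit Types S T U : finType.

Definition mat S T (f : S -> T -> K) : 'M_(#|S|, #|T|) :=
  \matrix_(i, j) f (enum_val i) (enum_val j).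

Lemma sum_enum_val T (F : T -> K) : \sum_(i < #|T|) F (enum_val i) = \sum_t F t.
Proof.
rewrite [RHS](reindex (fun i : 'I_#|T| => enum_val i)) //.
by exists enum_rank => t _; rewrite ?enum_valK ?enum_rankK.
Qed.

Lemma mat_mul S T U (f : S -> T -> K) (g : T -> U -> K) :
  mat f *m mat g = mat (fun s u => \sum_t f s t * g t u).
Proof.
apply/matrixP => i j; rewrite !mxE -[RHS]sum_enum_val.
by apply: eq_bigr => t _; rewrite !mxE.
Qed.

Lemma mat_tr S T (f : S -> T -> K) : (mat f)^T = mat (fun t s => f s t).
Proof. by apply/matrixP => i j; rewrite !mxE. Qed.

Lemma mat_rank_ge S T (f : S -> T -> K) (u : S -> K) :
  (forall h : S -> K, (forall t, \sum_s h s * f s t = 0) ->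
     exists c, forall s, h s = c * u s) ->
  (#|S| <= (\rank (mat f)).+1)%N.
Proof.
move=> H; pose v : 'rV_#|S| := \row_i u (enum_val i).
have : (\rank (kermx (mat f)) <= 1)%N.
  apply: leq_trans (rank_leq_row v); apply: mxrankS; apply/row_subP => i.
  have : row i (kermx (mat f)) *m mat f = 0.
    by rewrite -row_mul mulmx_ker row0.
  set h := row i _ => hf.
  have [t|c cE] := H (fun s => h 0 (enum_rank s)).
    rewrite -[LHS]sum_enum_val; under eq_bigr => s _ do rewrite enum_valK.
    have := congr1 (fun m : 'rV_#|T| => m 0 (enum_rank t)) hf.
    rewrite !mxE => H0; rewrite -[RHS]H0; apply: eq_bigr => s _.
    by rewrite [mat f _ _]mxE enum_rankK.
  rewrite (_ : h = c *: v) ?scalemx_sub //.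
  by apply/rowP => j; rewrite [RHS]mxE [v _ _]mxE -cE enum_valK.
by rewrite mxrank_ker leq_subLR addn1.
Qed.

Lemma mat_rank_le S T U (f : S -> T -> K) (g : U -> T -> K) :
  (forall s, exists c : U -> K, forall t, f s t = \sum_u c u * g u t) ->
  (\rank (mat f) <= #|U|)%N.
Proof.
move/choice => [c cE]; have -> : mat f = mat c *m mat g.
  by rewrite mat_mul; apply/matrixP => i j; rewrite !mxE cE.
exact: leq_trans (mulmx_max_rank _ _).
Qed.

(** Sylvester's rank inequality. *)
Lemma mat_rank_mul S T U (f : S -> T -> K) (g : T -> U -> K) :
  (\rank (mat f) + \rank (mat g) <= \rank (mat f *m mat g) + #|T|)%N.
Proof.
rewrite -(mxrank_mul_ker (mat f) (mat g)).
have : (\rank (mat f :&: kermx (mat g)) <= #|T| - \rank (mat g))%N.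
  by rewrite -mxrank_ker mxrankS // capmxSr.
have := rank_leq_row (mat g); lia.
Qed.

Lemma sum_sig_delta T (A : {set T}) (t0 : T) (h : T -> K) : t0 \in A ->
  \sum_(t : {t | t \in A}) (val t == t0)%:R * h (val t) = h t0.
Proof.
move=> t0A; rewrite (bigD1 (exist _ t0 t0A)) //= eqxx mul1r big1 ?addr0 // => t.
by rewrite -val_eqE /= => /negPf ->; rewrite mul0r.
Qed.

Lemma card_sig_set T (A : {set T}) : #|{: {t | t \in A}}| = #|A|.
Proof. by rewrite card_sig; apply: eq_card => t; rewrite !inE. Qed.

End FinTypeMatrices.

Section Homology.
Variable G : brane_tiling.
Local Notation wv := (porbit (rotw G)).
Local Notation bv := (porbit (rotb G)).
Implicit Types J D B S : {set G}.

(** A disjoint sum, because a white and a black vertex may have the same set of edges. *)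
Let V : finType :=
  ({v : {set G} | v \in white_vertices G} + {v : {set G} | v \in black_vertices G})%type.

(** Unsigned incidence: as [G] is bipartite, changing signs at the black vertices gives the boundary
    map of the graph. *)
Let inc (a : G) (v : V) : rat :=
  match v with inl v => (a \in val v)%:R | inr v => (a \in val v)%:R end.

(** A linear relation takes opposite values at the two ends of every edge, so by connectedness of
    [G] it is a multiple of the function 1 on white and -1 on black vertices. *)
Lemma incidence_rank : (#|V| <= (\rank (mat inc)).+1)%N.
Proof.
rewrite -mxrank_tr mat_tr.
apply: (@mat_rank_ge _ _ _ _ (fun v : V => if v is inl _ then 1 else -1)) => h H.
have memw a : wv a \in white_vertices G by exact: imset_f.
have memb a : bv a \in black_vertices G by exact: imset_f.
pose hw (v : {set G}) := if insub v is Some w then h (inl w) else 0.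
pose hb (v : {set G}) := if insub v is Some w then h (inr w) else 0.
have E a : hw (wv a) + hb (bv a) = 0.
  rewrite -[RHS](H a) big_sumType /=; congr (_ + _).
    rewrite -(@sum_sig_delta _ _ (white_vertices G) (wv a) hw (memw a)).
    apply: eq_bigr => v _; rewrite mulrC /hw valK; congr (_ * _%:R).
    congr nat_of_bool; apply/eqP/idP => [->|av]; first exact: porbit_id.
    exact: mem_porbits_eq (valP v) av.
  rewrite -(@sum_sig_delta _ _ (black_vertices G) (bv a) hb (memb a)).
  apply: eq_bigr => v _; rewrite mulrC /hb valK; congr (_ * _%:R).
  congr nat_of_bool; apply/eqP/idP => [->|av]; first exact: porbit_id.
  exact: mem_porbits_eq (valP v) av.
have [a0 _] := edge_inhabited G.
have hwc a : hw (wv a) = hw (wv a0).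
  apply: (@rot_invariant_const _ _ (fun a => hw (wv a))) => c; first by rewrite porbit_step.
  by apply: (addIr (hb (bv c))); rewrite E -[in LHS](porbit_step (rotb G)) E.
exists (hw (wv a0)) => -[[v vw]|[v vb]].
  case/imsetP: (vw) => a _ va; rewrite mulr1 -(hwc a) -va /hw.
  by rewrite insubT.
case/imsetP: (vb) => a _ va; rewrite mulrN1 -(hwc a).
apply/eqP; rewrite -addr_eq0 addrC -[X in _ == X](E a) -va /hb.
by rewrite insubT.
Qed.

Section Bound.
Variables (J S : {set G}).
Hypotheses (J_connected : dual_connected J) (SJ : S \subset J).

(** The rows are the boundaries of the faces of [G], indexed by the vertices of the dual quiver,
    together with the single edges of [S]. *)
Let bd (s : Q0 G + {a | a \in S}) (a : G) : rat :=
  match s with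
  | inl i => (tgt a == i)%:R - (src a == i)%:R
  | inr b => (val b == a)%:R
  end.

Lemma sum_delta (T : finType) (h : T -> rat) t0 : \sum_t h t * (t0 == t)%:R = h t0.
Proof.
rewrite (bigD1 t0) //= eqxx mulr1 big1 ?addr0 // => t /negPf.
by rewrite eq_sym => ->; rewrite mulr0.
Qed.

(** In a relation the face coefficients agree across every edge outside [S], hence are all equal by
    connectedness outside [J]; the coefficients on [S] are then 0. Thus no nonzero combination of
    edges of [S] is a boundary. *)
Lemma boundary_rank : (#|{: Q0 G}| + #|S| <= (\rank (mat bd)).+1)%N.
Proof.
rewrite -(card_sig_set S) -card_sum.
apply: (@mat_rank_ge _ _ _ _ (fun s => if s is inl _ then 1 else 0)) => h H.
pose hs a := if insub a is Some w then h (inr w) else 0.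
have E a : h (inl (tgt a)) - h (inl (src a)) + hs a = 0.
  rewrite -[RHS](H a) big_sumType /=; congr (_ + _).
    under eq_bigr => i _ do rewrite mulrBr.
    by rewrite sumrB !(sum_delta (fun i => h (inl i))).
  rewrite /hs; case: insubP => [w wS wa|aS].
    rewrite (bigD1 w) //= wa eqxx mulr1 big1 ?addr0 // => u.
    by rewrite -val_eqE /= wa => /negPf ->; rewrite mulr0.
  rewrite big1 // => u _; case: eqP => [ua|]; last by rewrite mulr0.
  by move: aS; rewrite -ua (valP u).
have [a0 _] := edge_inhabited G.
have cst i : h (inl i) = h (inl (src a0)).
  suff /setP/(_ i) : [set i | h (inl i) == h (inl (src a0))]%SET = [set: Q0 G]%SET.
    by rewrite !inE => /eqP.
  apply: J_connected => [|a aJ].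
    by apply/set0Pn; exists (src a0); rewrite inE.
  rewrite !inE; have := E a; rewrite {1}/hs insubN ?addr0.
    by move/eqP; rewrite subr_eq0 => /eqP ->.
  by apply: contra aJ; exact: (fintype.subsetP SJ).
exists (h (inl (src a0))) => -[i|b]; first by rewrite mulr1 cst.
rewrite mulr0; have := E (val b); rewrite !cst subrr add0r /hs valK //.
Qed.

(** A boundary has no boundary: around a vertex of [G] sources and targets of the arrows cancel
    cyclically. *)
Lemma boundary_incidence (s : Q0 G + {a | a \in S}) v :
  \sum_a bd s a * inc a v = if s is inr b then inc (val b) v else 0.
Proof.
case: s => [i|b] /=; last first.
  rewrite (bigD1 (val b)) //= eqxx mul1r big1 ?addr0 // => a.
  by rewrite eq_sym => /negPf ->; rewrite mul0r.
have E (u : {set G}) : is_quiver_face u ->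
    \sum_a ((tgt a == i)%:R - (src a == i)%:R) * (a \in u)%:R = 0 :> rat.
  move=> uF.
  transitivity (\sum_(a in u) ((tgt a == i)%:R - (src a == i)%:R : rat)).
    rewrite [RHS]big_mkcond; apply: eq_bigr => a _.
    by case: (a \in u); rewrite ?mulr1 ?mulr0.
  rewrite sumrB; apply/eqP; rewrite subr_eq0; apply/eqP.
  case/orP: uF => uF; last first.
    exact: (big_porbit_step _ (fun a => (src a == i)%:R)).
  under eq_bigr => a _ do rewrite -src_rotw_inv.
  apply: (big_porbit_step _ (fun a => (src a == i)%:R)).
  by rewrite porbitsV.
by case: v => v /=; apply: E; rewrite /is_quiver_face (valP v) ?orbT.
Qed.

(** Sylvester's inequality gives [(#|Q0| + #|S| - 1) + (#|V| - 1) <= #|U| + #|G|], and the Euler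
    relation [#|V| + #|Q0| = #|G|] leaves the 2, the rank of the homology of the torus. *)
Lemma incidence_span_bound (U : finType) (g : U -> V -> rat) :
  (forall a, a \in S -> exists c : U -> rat,
     forall v, inc a v = \sum_u c u * g u v) -> (#|S| <= #|U|.+2)%N.
Proof.
move=> H.
have r1 : (\rank (mat bd *m mat inc) <= #|U|)%N.
  rewrite mat_mul; apply: (@mat_rank_le _ _ _ _ _ g) => -[i|b].
    by exists (fun=> 0) => v; rewrite boundary_incidence big1 // => u _; rewrite mul0r.
  have [c cE] := H _ (valP b).
  by exists c => v; rewrite boundary_incidence cE.
have euler : (#|V| + #|{: Q0 G}| = #|G|)%N.
  rewrite card_sum !card_sig_set -[RHS](euler_torus G); congr (_ + _)%N.
move: r1 (mat_rank_mul bd inc) boundary_rank incidence_rank euler.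
move: (\rank (mat bd)) (\rank (mat inc)) (\rank (mat bd *m mat inc)) => r2 r3 r4.
move: #|V| #|{: Q0 G}| #|G| #|S| #|U| => n1 n2 n3 n4 n5; lia.
Qed.

End Bound.

(** In each of the two vertex-disjoint parts white and black incidences have equal sums, which
    lowers the dimension of the span of the edges by 1 per part. These two units cancel the 2 of
    [incidence_span_bound]. *)
Lemma disjoint_subgraphs_bound J D B (a b : G) :
  dual_connected J -> D \subset J -> B \subset J -> a \in D -> b \in B ->
  (forall c c', c \in D -> c' \in B -> wv c != wv c' /\ bv c != bv c') ->
  (#|D| + #|B| <= #|wv @: D| + #|bv @: D| + (#|wv @: B| + #|bv @: B|))%N.
Proof.
move=> con DJ BJ aD bB dis.
have DB : [disjoint D & B].
  apply/pred0P => c; apply/negP => /andP[/= cD cB].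
  by have [/eqP] := dis _ _ cD cB.
have -> : (#|D| + #|B| = #|D :|: B|)%N.
  by rewrite cardsU disjoint_setI0 // cards0 subn0.
pose W := (wv @: (D :|: B))%SET.
pose X := (bv @: (D :|: B) :\ bv a :\ bv b)%SET.
pose dw (v : {set G}) (u : V) : rat := if u is inl u then (val u == v)%:R else 0.
pose db (v : {set G}) (u : V) : rat := if u is inr u then (val u == v)%:R else 0.
(* The black ends of [a] and [b] serve as base vertices of the two parts. The span is generated by
   white vertices plus their base and by the other black vertices minus their base. *)
pose basew (v : {set G}) := if v \in wv @: D then bv a else bv b.
pose baseb (v : {set G}) := if v \in bv @: D then bv a else bv b.
pose U : finType := ({v | v \in W} + {v | v \in X})%type.
pose g (u : U) (v : V) := match u with
  | inl w => dw (val w) v + db (basew (val w)) v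
  | inr w => db (val w) v - db (baseb (val w)) v
  end.
have incE c u : inc c u = dw (wv c) u + db (bv c) u.
  case: u => [u|u]; rewrite /= ?addr0 ?add0r; congr (_%:R); congr nat_of_bool.
    by apply/idP/eqP => [cu|->]; [exact: mem_porbits_eq (valP u) cu | exact: porbit_id].
  by apply/idP/eqP => [cu|->]; [exact: mem_porbits_eq (valP u) cu | exact: porbit_id].
have baseE c : c \in D :|: B -> basew (wv c) = baseb (bv c) /\
    (bv c \notin X -> bv c = basew (wv c)).
  move=> cS.
  have cX : bv c \notin X -> bv c = bv a \/ bv c = bv b.
    rewrite !inE (imset_f _ cS) andbT negb_and !negbK.
    by case/orP => /eqP; [right | left].
  move: cS; rewrite inE => /orP[cD|cB]; rewrite /basew /baseb.
    rewrite !imset_f //; split => // /cX[//|cb].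
    by have [_ /eqP] := dis _ _ cD bB.
  rewrite !ifN; first split => // /cX[ca|//].
  - by have [_ /eqP] := dis _ _ aD cB; rewrite ca.
  - by apply/imsetP => -[c' c'D /esym/eqP E]; have [_ /negP] := dis _ _ c'D cB.
  - by apply/imsetP => -[c' c'D /esym/eqP E]; have [/negP] := dis _ _ c'D cB.
have bound : (#|D :|: B| <= #|U|.+2)%N.
  apply: (@incidence_span_bound J _ con _ U g) => [|c cS].
    by rewrite finset.subUset DJ.
  have [bE bX] := baseE c cS.
  exists (fun u => match u with inl w => (val w == wv c)%:R
                   | inr w => (val w == bv c)%:R end) => v.
  rewrite big_sumType /= incE.
  rewrite (sum_sig_delta (fun w => dw w v + db (basew w) v)) ?imset_f //.
  have [cX|cX] := boolP (bv c \in X).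
    by rewrite (sum_sig_delta (fun w => db w v - db (baseb w) v)) // bE; ring.
  rewrite big1 => [|u _]; first by rewrite -bX // addr0.
  case: eqP => [uc|]; last by rewrite mul0r.
  by move: cX; rewrite -uc (valP u).
have cardX : #|bv @: (D :|: B)| = #|X|.+2.
  rewrite (cardsD1 (bv a)) imset_f ?inE ?aD // (cardsD1 (bv b) (_ :\ _)) !inE.
  rewrite imset_f ?inE ?bB ?orbT // andbT.
  by have [_ ne] := dis _ _ aD bB; rewrite eq_sym ne.
move: bound; rewrite card_sum !card_sig_set -!addnS -cardX => /leq_trans; apply.
rewrite addnACA; apply: leq_add.
  by rewrite /W imsetU cardsU leq_subr.
by rewrite imsetU cardsU leq_subr.
Qed.

End Homology.

(** * Subgraphs and perfect matchings *)

Section Subgraphs.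
Variable G : brane_tiling.
Local Notation wv := (porbit (rotw G)).
Local Notation bv := (porbit (rotb G)).
Implicit Types (I J D B P v : {set G}).

(** For [c] in [J]: the end of [c] around which [s] turns is a leaf of [J]. *)
Definition alone (s : {perm G}) J c :=
  forall d, d \in J -> porbit s d = porbit s c -> d = c.

(** The combinatorial trace of the relations on a nonempty cosupport, shared by perfect matchings:
    it covers all vertices, and one end of an edge is a leaf exactly when the other is. *)
Definition saturated J :=
  [/\ forall c, exists2 d, d \in J & wv d = wv c,
      forall c, exists2 d, d \in J & bv d = bv c
    & forall c, c \in J -> alone (rotw G) J c <-> alone (rotb G) J c].

Lemma prod_eq0_alone (R : realType) (x : rep G R) (s : {perm G}) c :
  c \in cosupport x ->
  alone s (cosupport x) c <-> \prod_(b in porbit s c :\ c) x b != 0.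
Proof.
move=> cJ; split=> [al|/prodf_neq0 H d dJ dc].
  apply/prodf_neq0 => d; rewrite !inE => /andP[dc dcs].
  apply: contra dc => xd; apply/eqP/al; first by rewrite inE.
  by apply/eqP; rewrite eq_porbit_mem.
apply/eqP; apply: contraT => ne; have := H d.
by rewrite !inE ne -eq_porbit_mem dc eqxx => /(_ isT)/negP; move: dJ; rewrite inE.
Qed.

(** One face product vanishes, hence all do. The relation at [c] says that the products of the other
    edges at its two ends vanish together. *)
Lemma cosupport_saturated (R : realType) (x : rep G R) : in_repA x ->
  cosupport x != finset.set0 -> saturated (cosupport x).
Proof.
move=> xA /set0Pn[c0 c0J].
have prod0 F : is_quiver_face F -> exists2 d, d \in cosupport x & d \in F.
  move=> HF; have := repA_equal_products xA HF (wv_face c0).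
  rewrite [RHS](bigD1 c0) ?porbit_id //=; move: c0J; rewrite inE => /eqP ->.
  move/eqP; rewrite mul0r prodf_seq_eq0 => /hasP[d _ /andP[dF xd]].
  by exists d; rewrite ?inE.
split=> [c|c|c cJ].
- have [d dJ dc] := prod0 _ (wv_face c); exists d => //.
  by apply/eqP; rewrite eq_porbit_mem.
- have [d dJ dc] := prod0 _ (bv_face c); exists d => //.
  by apply/eqP; rewrite eq_porbit_mem.
by rewrite !prod_eq0_alone // (in_repAP x).1.
Qed.

Lemma perfect_matchingP P : perfect_matching P <->
  [/\ forall c, exists2 d, d \in P & wv d = wv c,
      forall c, exists2 d, d \in P & bv d = bv c
    & forall c, c \in P -> alone (rotw G) P c /\ alone (rotb G) P c].
Proof.
have E (s : {perm G}) c : #|porbit s c :&: P| = 1%N <->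
    (exists2 d, d \in P & porbit s d = porbit s c) /\
    (forall d e, d \in P -> e \in P -> porbit s d = porbit s c ->
      porbit s e = porbit s c -> d = e).
  have mE d : (d \in porbit s c) = (porbit s d == porbit s c) by rewrite eq_porbit_mem.
  split=> [/eqP/cards1P[d dE]|[[d dP ds] H]].
    have := set11 d; rewrite -dE inE mE => /andP[/eqP ds dP].
    split; first by exists d.
    move=> e f eP fP es fs.
    have : e \in [set d] by rewrite -dE inE mE es eqxx.
    have : f \in [set d] by rewrite -dE inE mE fs eqxx.
    by rewrite !inE => /eqP -> /eqP ->.
  apply/eqP/cards1P; exists d; apply/setP => e; rewrite !inE mE.
  by apply/andP/eqP => [[/eqP es eP]|->]; [exact: H | rewrite ds eqxx].
split=> [PM|[Pw Pb Pa] v /quiver_faceP[c [->|->]]].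
- split=> [c|c|c cP].
  + by have /E[] := PM _ (wv_face c).
  + by have /E[] := PM _ (bv_face c).
  + have /E[_ Hw] := PM _ (wv_face c); have /E[_ Hb] := PM _ (bv_face c).
    by split=> d dP dc; [apply: Hw | apply: Hb].
- apply/E; split=> // d e dP eP ds es.
  by have [+ _] := Pa _ eP; apply => //; rewrite es.
- apply/E; split=> // d e dP eP ds es.
  by have [_] := Pa _ eP; apply => //; rewrite es.
Qed.

Lemma perfect_matching_saturated P : perfect_matching P -> saturated P.
Proof.
move/perfect_matchingP => [Pw Pb Pa]; split => // c cP.
by have [aw ab] := Pa _ cP; split.
Qed.

Lemma card_porbit_sum (s : {perm G}) J :
  #|J| = (\sum_(v in porbit s @: J) #|v :&: J|)%N.
Proof.
rewrite -sum1_card (partition_big_imset (porbit s)) /=.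
apply: eq_bigr => v /imsetP[c cJ ->]; rewrite -sum1_card; apply: eq_bigl => d.
by rewrite inE andbC eq_porbit_mem.
Qed.

Section BigComponent.
Variables (I D : {set G}) (c0 : G).
Hypotheses (I_sat : saturated I) (I_con : dual_connected I).
Hypotheses (c0I : c0 \in I) (DE : D = component I c0).

Lemma component_sub : D \subset I.
Proof.
apply/fintype.subsetP => d; rewrite DE inE => /connectP[p]; elim/last_ind: p => [_ ->//|p e _].
by rewrite last_rcons rcons_path => /andP[_ /and3P[_ eI _]] ->.
Qed.

Lemma component_closed c d : c \in D -> d \in I ->
  wv d = wv c \/ bv d = bv c -> d \in D.
Proof.
move=> cD dI dc; have cI := fintype.subsetP component_sub _ cD.
move: cD; rewrite DE !inE => cD; apply: connect_trans cD _; apply: connect1.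
by rewrite /edge_adjacent /= cI dI; case: dc => ->; rewrite eqxx ?orbT.
Qed.

Lemma trivalent_card (s : {perm G}) v0 : v0 \in porbits s ->
  #|v0 :&: D| = 3%N ->
  (forall v, v \in porbits s -> v != v0 -> v :&: D != finset.set0 -> #|v :&: D| = 2%N) ->
  #|D| = (#|porbit s @: D|.*2.+1)%N.
Proof.
move=> v0s v03 H; rewrite (card_porbit_sum s).
have v0D : v0 \in porbit s @: D.
  have /card_gt0P[c] : (0 < #|v0 :&: D|)%N by rewrite v03.
  by rewrite inE => /andP[cv cD]; rewrite (mem_porbits_eq v0s cv) imset_f.
rewrite (big_setD1 v0) //= v03 (cardsD1 v0 (_ @: _)) v0D.
rewrite (eq_bigr (fun=> 2%N)) ?sum_nat_const; first by lia.
move=> v; rewrite !inE => /andP[vv0 /imsetP[c cD vE]]; apply: H => //.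
  by rewrite vE; exact: imset_f.
by apply/set0Pn; exists c; rewrite inE vE porbit_id.
Qed.

Lemma bivalent_card (s : {perm G}) B :
  (forall c, c \in B -> ~ alone s B c) -> (#|porbit s @: B|.*2 <= #|B|)%N.
Proof.
move=> H; rewrite (card_porbit_sum s B) -muln2 -sum_nat_const.
apply: leq_sum => v /imsetP[c cB ->].
have /existsNP[d /not_implyP[dB /not_implyP[ds dc]]] := H _ cB.
rewrite -(_ : #|[set c; d]| = 2%N); last by rewrite cards2 eq_sym; case: eqP.
apply/subset_leq_card/fintype.subsetP => e; rewrite !inE => /orP[] /eqP ->.
  by rewrite porbit_id cB.
by rewrite dB andbT -eq_porbit_mem ds.
Qed.

(** The big component has one edge more than it has vertices. If some edge outside it had an end
    that is not a leaf, such edges would form a disjoint subgraph with at least as many edges as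
    vertices, and the two would exceed [disjoint_subgraphs_bound]. *)
Lemma outside_component_alone vw vb : trivalent_vertices D vw vb ->
  forall c, c \in I -> c \notin D -> alone (rotw G) I c /\ alone (rotb G) I c.
Proof.
case=> -[vww vw3] [vbb vb3] Dw Db c cI cD.
have [Iw Ib Ia] := I_sat.
have [/[dup] /(Ia c cI)//|na] := pselect (alone (rotw G) I c).
(* By saturation the condition at the white end also holds at the black end, and it is inherited by
   adjacent edges, so all valences in [B] are at least 2. *)
pose B := [set d in I | (d \notin D) && `[< ~ alone (rotw G) I d >]]%SET.
have BP d : reflect [/\ d \in I, d \notin D & ~ alone (rotw G) I d] (d \in B).
  by rewrite finset.inE; apply: (iffP and3P) => -[? ? /asboolP ?]; split => //; apply/asboolP.
have Bal (s : {perm G}) d : (s = rotw G \/ s = rotb G) -> d \in B -> ~ alone s B d.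
  move=> sE /BP[dI dD dna] al.
  have nal (f : G) : f \in I -> alone s I f <-> alone (rotw G) I f.
    by move=> fI; case: sE => -> //; rewrite Ia.
  apply: dna; apply/nal => // e eI ed; have [//|ne] := eqVneq e d.
  apply: al => //; apply/BP; split => //.
    apply: contra dD => eD; apply: component_closed eD dI _.
    by case: sE ed => -> ed; [left | right].
  by move/(nal _ eI)/(_ _ dI (esym ed)) => de; move: ne; rewrite de eqxx.
have cB : c \in B by apply/BP.
have DI := component_sub.
have BI : B \subset I by apply/fintype.subsetP => d /BP[].
have /set0Pn[d] : vw :&: D != finset.set0 by rewrite -card_gt0 vw3.
rewrite finset.inE => /andP[_ dD].
have := disjoint_subgraphs_bound I_con DI BI dD cB.
rewrite leqNgt => /(_ _)/negP; case.
  move=> e f eD /BP[fI fD _]; split; apply: contra fD => /eqP ef.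
    by apply: component_closed eD fI _; left.
  by apply: component_closed eD fI _; right.
have := trivalent_card vww vw3 Dw; have := trivalent_card vbb vb3 Db.
have := bivalent_card (fun e => @Bal _ e (or_introl erefl)).
have := bivalent_card (fun e => @Bal _ e (or_intror erefl)).
lia.
Qed.

End BigComponent.

(* The chain [i] is o i 0, e i 0, o i 1, e i 1, ..., o i (k i); the edges [o i l]
   and [e i l] share a black vertex, [e i l] and [o i l.+1] a white one. *)
Record chain_system I D (k : 'I_3 -> nat) (o e : 'I_3 -> nat -> G) : Prop := {
  cs_sub : D \subset I;
  cs_alone : forall c, c \in I -> c \notin D ->
    alone (rotw G) I c /\ alone (rotb G) I c;
  cs_odd : forall i l, (l <= k i)%N -> o i l \in D;
  cs_even : forall i l, (l < k i)%N -> e i l \in D;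
  cs_cover : forall c, c \in D -> exists i,
    (exists2 l, (l <= k i)%N & c = o i l) \/ (exists2 l, (l < k i)%N & c = e i l);
  cs_odd_inj : forall i i' l l', (l <= k i)%N -> (l' <= k i')%N ->
    o i l = o i' l' -> i = i' /\ l = l';
  cs_even_inj : forall i i' l l', (l < k i)%N -> (l' < k i')%N ->
    e i l = e i' l' -> i = i' /\ l = l';
  cs_odd_even : forall i i' l l', (l <= k i)%N -> (l' < k i')%N -> o i l <> e i' l';
  cs_white_end : forall i j, wv (o i 0%N) = wv (o j 0%N);
  cs_black_end : forall i j, bv (o i (k i)) = bv (o j (k j));
  cs_white : forall i l, (l < k i)%N -> wv (e i l) = wv (o i l.+1);
  cs_black : forall i l, (l < k i)%N -> bv (o i l) = bv (e i l);
  cs_white_endP : forall i d, d \in I -> wv d = wv (o i 0%N) -> exists j, d = o j 0%N;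
  cs_black_endP : forall i d, d \in I -> bv d = bv (o i (k i)) -> exists j, d = o j (k j);
  cs_whiteP : forall i l d, (l < k i)%N -> d \in I -> wv d = wv (e i l) ->
    d = e i l \/ d = o i l.+1;
  cs_blackP : forall i l d, (l < k i)%N -> d \in I -> bv d = bv (o i l) ->
    d = o i l \/ d = e i l
}.

Lemma card2_mem (T : finType) (A : {set T}) x y d : #|A| = 2%N ->
  x \in A -> y \in A -> d \in A -> x != y -> d = x \/ d = y.
Proof.
move=> A2 xA yA dA xy; have /eqP AE : [set x; y]%SET == A.
  rewrite eqEcard cards2 xy A2 andbT; apply/fintype.subsetP => z.
  by rewrite !inE => /orP[] /eqP ->.
by move: dA; rewrite -AE !inE => /orP[] /eqP; [left | right].
Qed.

(** Edges of [I] adjacent to an edge of [D] lie in the component [D], so the valences 3 and 2 leave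
    no edges at these vertices besides those of the chains. The index [l] counts from 0 the odd and
    the even positions of a chain. *)
Lemma connecting_chain_system I D k a : saturated I -> dual_connected I ->
  big_component I D -> connecting_chains D k a ->
  chain_system I D k (fun i l => a i l.*2.+1) (fun i l => a i l.*2.+2).
Proof.
move=> I_sat I_con [[c0 c0I DE] _] [vw [vb [tri ends links inj mem]]].
have [[vww vw3] [vbb vb3] Dw Db] := tri.
have alone_out := outside_component_alone I_sat I_con c0I DE tri.
have DI := component_sub c0I DE.
have clos := component_closed c0I DE.
have oD i l : (l <= k i)%N -> a i l.*2.+1 \in D.
  by move=> H; apply/mem; exists i, l.*2.+1; rewrite /= ltnS leq_double.
have eD i l : (l < k i)%N -> a i l.*2.+2 \in D.
  by move=> H; apply/mem; exists i, l.*2.+2; rewrite /= ltnS; split => //; lia.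
have oinj i i' l l' : (l <= k i)%N -> (l' <= k i')%N ->
    a i l.*2.+1 = a i' l'.*2.+1 -> i = i' /\ l = l'.
  by move=> Hl Hl' /inj[||-> /eqP]; [lia|lia|rewrite eqSS => /eqP /double_inj].
have einj i i' l l' : (l < k i)%N -> (l' < k i')%N ->
    a i l.*2.+2 = a i' l'.*2.+2 -> i = i' /\ l = l'.
  by move=> Hl Hl' /inj[||-> /eqP]; [lia|lia|rewrite !eqSS => /eqP /double_inj].
have oe i i' l l' : (l <= k i)%N -> (l' < k i')%N -> a i l.*2.+1 <> a i' l'.*2.+2.
  by move=> Hl Hl' /inj[||_]; lia.
have wE i : wv (a i 1%N) = vw by apply/esym/mem_porbits_eq; [|have [] := ends i].
have bE i : bv (a i (k i).*2.+1) = vb.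
  by apply/esym/mem_porbits_eq; [|have [] := ends i].
have lw i l : (l < k i)%N -> wv (a i l.*2.+2) = wv (a i l.+1.*2.+1).
  move=> Hl; have := links i l.*2.+2; rewrite /= odd_double /= doubleS; apply.
  by lia.
have lb i l : (l < k i)%N -> bv (a i l.*2.+1) = bv (a i l.*2.+2).
  by move=> Hl; have := links i l.*2.+1; rewrite /= odd_double /=; apply; lia.
have three v (f : 'I_3 -> G) : injective f -> #|v :&: D| = 3%N ->
    (forall i, f i \in v :&: D) -> forall d, d \in v :&: D -> exists j, d = f j.
  move=> finj v3 fv d; suff -> : v :&: D = [set f i | i : 'I_3].
    by case/imsetP => j _ ->; exists j.
  apply/esym/eqP; rewrite eqEcard card_imset // card_ord v3 leqnn andbT.
  by apply/fintype.subsetP => _ /imsetP[i _ ->].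
have winj : injective (fun i => a i 1%N) by move=> i j /(oinj i j 0 0)[].
have binj : injective (fun i => a i (k i).*2.+1).
  by move=> i j /(oinj i j _ _ (leqnn _) (leqnn _))[].
have wend d : d \in D -> wv d = vw -> exists j, d = a j 1%N.
  move=> dD dv; apply: (three _ _ winj vw3) => [i|].
    by rewrite inE -{1}(wE i) porbit_id (oD i 0%N).
  by rewrite inE -dv porbit_id.
have bend d : d \in D -> bv d = vb -> exists j, d = a j (k j).*2.+1.
  move=> dD dv; apply: (three _ _ binj vb3) => [i|].
    by rewrite inE -{1}(bE i) porbit_id (oD i (k i)).
  by rewrite inE -dv porbit_id.
split=> // [c /mem[i [j [Hj ->]]]|i j|i j|i d dI dw|i d dI db|i l d Hl dI dw|i l d Hl dI db].
- exists i; have := odd_double_half j; case: (odd j) => /= jE.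
    by left; exists j./2; [lia | congr (a i _); lia].
  by right; exists (j./2.-1); [lia | congr (a i _); lia].
- by rewrite !wE.
- by rewrite !bE.
- apply: wend; last by rewrite dw wE.
  by apply: (clos (a i 1%N)) => //; [exact: (oD i 0%N) | left].
- apply: bend; last by rewrite db bE.
  by apply: (clos (a i (k i).*2.+1)) => //; [exact: oD | right].
- have dD : d \in D by apply: (clos _ d (eD i l Hl)) => //; left.
  apply: (@card2_mem _ (wv (a i l.*2.+2) :&: D)).
  + apply: Dw; first exact: imset_f.
      (* The vertex is not the trivalent one: an even edge is not among the three first edges. *)
      apply/eqP => H; have [j] := wend _ (eD _ _ Hl) H.
      by move/esym; apply: (oe j i 0%N l).
    by apply/set0Pn; exists (a i l.*2.+2); rewrite inE porbit_id eD.
  + by rewrite inE porbit_id eD.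
  + by rewrite inE -eq_porbit_mem lw // eqxx oD.
  + by rewrite inE -eq_porbit_mem dw eqxx dD.
  + by apply/eqP => /esym; apply: oe.
- have dD : d \in D by apply: (clos _ d (oD i l (ltnW Hl))) => //; right.
  apply: (@card2_mem _ (bv (a i l.*2.+1) :&: D)).
  + apply: Db; first exact: imset_f.
      apply/eqP => H; have [j] := bend _ (oD _ _ (ltnW Hl)) H.
      case/oinj => [||ij lk]; [exact: ltnW|by []|].
      by move: Hl; rewrite lk ij ltnn.
    by apply/set0Pn; exists (a i l.*2.+1); rewrite inE porbit_id oD // ltnW.
  + by rewrite inE porbit_id oD // ltnW.
  + by rewrite inE -eq_porbit_mem lb // eqxx eD.
  + by rewrite inE -eq_porbit_mem db eqxx dD.
  + by apply/eqP; apply: oe => //; apply: ltnW.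
Qed.

(** * Alternating matchings and saturated subsets *)

Section ChainMatchings.
Variables (I D : {set G}) (k : 'I_3 -> nat) (o e : 'I_3 -> nat -> G).
Hypothesis cs : chain_system I D k o e.
Hypothesis I_sat : saturated I.

Variable P : 'I_3 -> {set G}.
Hypothesis P_sub : forall i, P i \subset I.
Hypothesis P_out : forall i c, c \in I -> c \notin D -> c \in P i.
Hypothesis P_odd : forall i j l, (l <= k j)%N -> (o j l \in P i) = (j == i).
Hypothesis P_even : forall i j l, (l < k j)%N -> (e j l \in P i) = (j != i).

Lemma chain_caseP (Q : G -> Prop) :
  (forall c, c \in I -> c \notin D -> Q c) ->
  (forall i l, (l <= k i)%N -> Q (o i l)) ->
  (forall i l, (l < k i)%N -> Q (e i l)) -> forall c, c \in I -> Q c.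
Proof.
move=> Qout Qo Qe c cI; have [cD|cD] := boolP (c \in D); last exact: Qout.
by have [i [[l Hl ->]|[l Hl ->]]] := cs_cover cs cD; [exact: Qo | exact: Qe].
Qed.

Section SaturatedSubset.
Variable J : {set G}.
Hypotheses (J_sat : saturated J) (JI : J \subset I).
Let inI c : c \in J -> c \in I := fintype.subsetP JI c.

Lemma sat_black_next i l : (l < k i)%N -> o i l \notin J -> e i l \in J.
Proof.
move=> Hl oJ; have [_ + _] := J_sat; move=> /(_ (o i l))[d dJ db].
by have [dE|<-//] := cs_blackP cs Hl (inI dJ) db; move: oJ; rewrite -dE dJ.
Qed.

Lemma sat_white_next i l : (l < k i)%N -> e i l \notin J -> o i l.+1 \in J.
Proof.
move=> Hl eJ; have [+ _ _] := J_sat; move=> /(_ (e i l))[d dJ dw].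
by have [dE|<-//] := cs_whiteP cs Hl (inI dJ) dw; move: eJ; rewrite -dE dJ.
Qed.

Lemma sat_alone c : c \in J -> alone (rotw G) J c <-> alone (rotb G) J c.
Proof. by have [_ _] := J_sat; exact. Qed.

(** If [o i l.+1] were missing, [e i l] would end in a leaf on its white side, hence also on its
    black side, which it shares with [o i l]. *)
Lemma sat_odd i : o i 0%N \in J -> forall l, (l <= k i)%N -> o i l \in J.
Proof.
move=> o0; elim=> [//|l IHl] Hl.
have [eJ|] := boolP (e i l \in J); last exact: sat_white_next.
apply: contraT => oJ.
have /(sat_alone eJ)/(_ _ (IHl (ltnW Hl)) (cs_black cs Hl)) :
    alone (rotw G) J (e i l).
  move=> d dJ dw; have [//|dE] := cs_whiteP cs Hl (inI dJ) dw.
  by move: oJ; rewrite -dE dJ.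
by move/(cs_odd_even cs (ltnW Hl) Hl).
Qed.

(** A missing odd edge forces the next even edge, which then has a leaf at its black end, hence at
    its white end, and excludes the following odd edge. *)
Lemma sat_even_off i : o i 0%N \notin J ->
  forall l, (l <= k i)%N -> o i l \notin J /\ ((l < k i)%N -> e i l \in J).
Proof.
move=> o0; elim=> [_|l IHl Hl]; first by split => // H; exact: sat_black_next.
have [oJ /(_ Hl) eJ] := IHl (ltnW Hl).
suff oJ' : o i l.+1 \notin J by split => // H; exact: sat_black_next.
apply/negP => oJ'.
have /(sat_alone eJ)/(_ _ oJ' (esym (cs_white cs Hl))) : alone (rotb G) J (e i l).
  move=> d dJ db; have [dE|//] := cs_blackP cs Hl (inI dJ) (etrans db (esym (cs_black cs Hl))).
  by move: oJ; rewrite -dE dJ.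
exact: (cs_odd_even cs).
Qed.

(** Not ending in a leaf passes from one end of an odd edge to the other by saturation, and on to
    the next odd edge through the even edge found there. *)
Lemma sat_even_on i : o i 0%N \in J -> ~ alone (rotw G) J (o i 0%N) ->
  forall l, (l < k i)%N -> e i l \in J.
Proof.
move=> o0 nal; suff H l : (l < k i)%N -> ~ alone (rotw G) J (o i l) -> e i l \in J.
  elim=> [|l IHl] Hl; first exact: H.
  apply: H => // /(_ _ (IHl (ltnW Hl)) (cs_white cs (ltnW Hl))) /esym.
  by apply: (cs_odd_even cs); rewrite // ltnW.
move=> Hl; rewrite (sat_alone (sat_odd o0 (ltnW Hl))) => {}nal.
apply: contraT => eJ; case: nal => d dJ db.
have [//|dE] := cs_blackP cs Hl (inI dJ) db.
by move: eJ; rewrite -dE dJ.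
Qed.

Lemma sat_even_alone i : o i 0%N \in J -> alone (rotw G) J (o i 0%N) ->
  forall l, (l < k i)%N -> e i l \notin J.
Proof.
move=> o0 al; suff H l : (l < k i)%N -> alone (rotw G) J (o i l) -> e i l \notin J.
  elim=> [|l IHl] Hl; first exact: H.
  apply: H => // d dJ; rewrite -(cs_white cs (ltnW Hl)) => dw.
  have [dE|//] := cs_whiteP cs (ltnW Hl) (inI dJ) dw.
  by have := IHl (ltnW Hl); rewrite -dE dJ.
move=> Hl /(sat_alone (sat_odd o0 (ltnW Hl))) {}al; apply/negP => eJ.
by have := al _ eJ (esym (cs_black cs Hl)) => /esym; apply: (cs_odd_even cs); rewrite // ltnW.
Qed.

(** For a chain [j] other than [i] whose first edge is in [J], this edge meets [o i 0] at the white
    end, so [sat_even_on] yields the even edges; otherwise [sat_even_off] does. *)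
Lemma sat_contains_matching i : o i 0%N \in J -> P i \subset J.
Proof.
move=> oi; apply/fintype.subsetP => c cP; have cI := fintype.subsetP (P_sub i) c cP.
move: c cI cP; apply: chain_caseP => [c cI cD _|j l Hl|j l Hl].
- have [al _] := cs_alone cs cI cD.
  have [+ _ _] := J_sat; move=> /(_ c)[d dJ dw].
  by rewrite -(al d (inI dJ) dw).
- by rewrite P_odd // => /eqP ji; rewrite ji in Hl *; exact: sat_odd.
- rewrite P_even // => ji; have [oj|oj] := boolP (o j 0%N \in J).
    apply: sat_even_on => // /(_ _ oi (cs_white_end cs i j)) /(cs_odd_inj cs)[]// ij.
    by rewrite ij eqxx in ji.
  by have [_] := sat_even_off oj (ltnW Hl); apply.
Qed.

Lemma sat_unique_matching i : o i 0%N \in J ->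
  (forall j, j != i -> o j 0%N \notin J) -> J = P i.
Proof.
move=> oi oj; apply/eqP; rewrite finset.eqEsubset sat_contains_matching // andbT.
apply/fintype.subsetP => c cJ; have cI := inI cJ; move: c cI cJ.
apply: chain_caseP => [c cI cD _|j l Hl|j l Hl]; first exact: P_out.
  rewrite P_odd // => oJ; apply: contraT => ji.
  by have [] := sat_even_off (oj j ji) Hl; rewrite oJ.
rewrite P_even // => eJ; apply/eqP => ji; move: eJ; apply/negP; rewrite ji in Hl *.
apply: sat_even_alone => // d dJ dw.
have [j' dE] := cs_white_endP cs (inI dJ) dw.
have [<-//|ne] := eqVneq j' i.
by have := oj _ ne; rewrite -dE dJ.
Qed.

Lemma sat_first_edge : exists i, o i 0%N \in J.
Proof.
have [+ _ _] := J_sat; move=> /(_ (o ord0 0%N))[d dJ dw].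
by have [j dE] := cs_white_endP cs (inI dJ) dw; exists j; rewrite -dE.
Qed.

End SaturatedSubset.

Lemma chain_matching_perfect i : perfect_matching (P i).
Proof.
have PI c : c \in P i -> c \in I := fintype.subsetP (P_sub i) c.
have [Iw Ib _] := I_sat.
apply/perfect_matchingP; split=> [c|c|c cP].
- have [d + <-] := Iw c; move: d; apply: chain_caseP => [d dI dD|j l Hl|j l Hl].
  + by exists d => //; exact: P_out.
  + have [ji|ji] := eqVneq j i; first by exists (o j l); rewrite ?P_odd // ji.
    case: l Hl => [|l] Hl; last first.
      by exists (e j l); [rewrite P_even | rewrite (cs_white cs) ?ji].
    by exists (o i 0%N); [rewrite P_odd | exact: (cs_white_end cs)].
  + have [ji|ji] := eqVneq j i; last by exists (e j l); rewrite ?P_even // ji.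
    exists (o j l.+1); first by rewrite P_odd // ji.
    by rewrite (cs_white cs).
- have [d + <-] := Ib c; move: d; apply: chain_caseP => [d dI dD|j l Hl|j l Hl].
  + by exists d => //; exact: P_out.
  + have [ji|ji] := eqVneq j i; first by exists (o j l); rewrite ?P_odd // ji.
    move: Hl; rewrite leq_eqVlt => /orP[/eqP ->|Hl].
      by exists (o i (k i)); [rewrite P_odd | exact: (cs_black_end cs)].
    by exists (e j l); [rewrite P_even | rewrite (cs_black cs)].
  + have [ji|ji] := eqVneq j i; last by exists (e j l); rewrite ?P_even // ji.
    exists (o j l); first by rewrite P_odd ?ji // -ji ltnW.
    by rewrite (cs_black cs).
have cI := PI c cP; move: c cI cP; apply: chain_caseP => [c cI cD cP|j l Hl|j l Hl].
- by have [aw ab] := cs_alone cs cI cD; split=> d /PI dI; [exact: aw | exact: ab].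
- rewrite P_odd // => /eqP ji; rewrite ji in Hl *; split=> d dP dv.
    case: l Hl dv => [|l] Hl dv.
      have [j' dE] := cs_white_endP cs (PI _ dP) dv.
      by move: dP; rewrite dE P_odd // => /eqP ->.
    rewrite -(cs_white cs Hl) in dv.
    have [dE|//] := cs_whiteP cs Hl (PI _ dP) dv.
    by move: dP; rewrite dE P_even // eqxx.
  move: Hl dv; rewrite leq_eqVlt => /orP[/eqP -> dv|Hl dv].
    have [j' dE] := cs_black_endP cs (PI _ dP) dv.
    by move: dP; rewrite dE P_odd // => /eqP ->.
  have [//|dE] := cs_blackP cs Hl (PI _ dP) dv.
  by move: dP; rewrite dE P_even // eqxx.
- rewrite P_even // => ji; split=> d dP dv.
    have [//|dE] := cs_whiteP cs Hl (PI _ dP) dv.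
    by move: dP; rewrite dE P_odd // (negPf ji).
  rewrite -(cs_black cs Hl) in dv.
  have [dE|//] := cs_blackP cs Hl (PI _ dP) dv.
  by move: dP; rewrite dE P_odd ?(negPf ji) // ltnW.
Qed.

(** A perfect matching is saturated and has exactly one edge at the white trivalent vertex, which
    singles out the chain. *)
Lemma perfect_matching_chain (Q : {set G}) : Q \subset I -> perfect_matching Q ->
  exists i, Q = P i.
Proof.
move=> QI PM; have Qsat := perfect_matching_saturated PM.
have [i oi] := sat_first_edge Qsat QI; exists i.
apply: sat_unique_matching => // j ji; apply/negP => oj.
have /perfect_matchingP[_ _ /(_ _ oi)[al _]] := PM.
have /(cs_odd_inj cs)[]// := al _ oj (cs_white_end cs j i).
by move=> ij; rewrite ij eqxx in ji.
Qed.

Lemma chain_matching_union : I = (\bigcup_i P i)%SET.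
Proof.
apply/setP => c; apply/idP/bigcupP => [|[i _]]; last exact: fintype.subsetP (P_sub i) c.
move: c; apply: chain_caseP => [c cI cD|j l Hl|j l Hl].
- by exists ord0 => //; exact: P_out.
- by exists j => //; rewrite P_odd.
- have [i ij] : exists i : 'I_3, j != i.
    by have [->|] := eqVneq j ord0; [exists ord_max | exists ord0].
  by exists i => //; rewrite P_even.
Qed.

End ChainMatchings.

End Subgraphs.

(** * One-parameter subgroups of the matchings *)

Section ChainMatchingEdges.
Variables (G : brane_tiling) (I D : {set G}) (k : 'I_3 -> nat).
Variable a : 'I_3 -> nat -> G.
Hypothesis cs : chain_system I D k (fun i l => a i l.*2.+1) (fun i l => a i l.*2.+2).

Lemma chain_matching_sub i : chain_matching I k a i \subset I.
Proof. by rewrite /chain_matching finset.setDDl finset.subsetDl. Qed.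

Lemma chain_matching_out i c : c \in I -> c \notin D ->
  c \in chain_matching I k a i.
Proof.
move=> cI cD; rewrite !inE cI andbT; apply/andP; split.
  apply/imsetP => -[[[|l] Hl]]; rewrite inE //= => _ cE.
  by move: cD; rewrite cE (cs_even cs).
apply/bigcupP => -[j _ /imsetP[[l Hl] _ cE]].
by move: cD; rewrite cE (cs_odd cs).
Qed.

Lemma chain_matching_odd i j l : (l <= k j)%N ->
  (a j l.*2.+1 \in chain_matching I k a i) = (j == i).
Proof.
move=> Hl; rewrite !inE (fintype.subsetP (cs_sub cs)) ?(cs_odd cs) // andbT.
have -> : a j l.*2.+1 \notin [set a i (val l0).*2 | l0 : 'I_(k i).+1 & (0 < val l0)%N].
  apply/imsetP => -[[[|l'] Hl']]; rewrite inE //= => _.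
  exact: (cs_odd_even cs).
rewrite /=; have [ji|ji] := eqVneq j i; last first.
  apply/negbTE; rewrite negbK; apply/bigcupP; exists j => //.
  by apply/imsetP; exists (Ordinal (n := (k j).+1) (m := l) Hl).
rewrite ji in Hl *.
apply/bigcupP => -[j' j'i /imsetP[[l' Hl'] _]] /(cs_odd_inj cs)[]// ij.
by move: j'i; rewrite ij eqxx.
Qed.

Lemma chain_matching_even i j l : (l < k j)%N ->
  (a j l.*2.+2 \in chain_matching I k a i) = (j != i).
Proof.
move=> Hl; rewrite !inE (fintype.subsetP (cs_sub cs)) ?(cs_even cs) // andbT.
have -> : a j l.*2.+2 \notin
    (\bigcup_(j' | j' != i) [set a j' (val l0).*2.+1 | l0 : 'I_(k j').+1])%SET.
  apply/bigcupP => -[j' j'i /imsetP[[l' Hl'] _]] /esym.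
  exact: (cs_odd_even cs).
rewrite andbT; congr (~~ _); apply/imsetP/eqP => [[[[|l'] Hl']]|ji].
- by rewrite inE.
- by move=> _ /= /(cs_even_inj cs)[].
have Hl1 : (l.+1 < (k i).+1)%N by rewrite -ji.
by exists (Ordinal Hl1); rewrite ?inE //= ji.
Qed.

End ChainMatchingEdges.

Section Lambda.
Variables (G : brane_tiling) (R : realType).
Implicit Types (x y z t : rep G R) (P : {set G}).
Local Notation C := R[i].
Local Notation wv := (porbit (rotw G)).
Local Notation bv := (porbit (rotb G)).

Definition lam r (P : 'I_r -> {set G}) (s : 'I_r -> C) : rep G R :=
  [ffun a => \prod_i (if a \in P i then s i else 1)].

(** Every vertex meets each matching in exactly one edge, so all face products equal the product of
    the [s i]. *)
Lemma lam_T_Lambda r (P : 'I_r -> {set G}) s :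
  (forall i, perfect_matching (P i)) -> torus s -> T_Lambda (lam P s).
Proof.
move=> PM ts; apply/T_LambdaP; split=> [a|].
  by rewrite ffunE; apply/prodf_neq0 => i _; case: ifP => // _; exact: oner_neq0.
suff E F : is_quiver_face F -> \prod_(a in F) lam P s a = \prod_i s i.
  by move=> F F' HF HF'; rewrite !E.
move=> HF; under eq_bigr => a _ do rewrite ffunE.
rewrite exchange_big /=; apply: eq_bigr => i _.
have /eqP/cards1P[c FP] := PM i F HF.
have : c \in F :&: P i by rewrite FP set11.
rewrite inE => /andP[cF cP]; rewrite (bigD1 c) //= cP big1 ?mulr1 // => d /andP[dF dc].
case: ifP => // dP; have : d \in F :&: P i by rewrite inE dF.
by rewrite FP inE (negPf dc).
Qed.

Definition cut (z : rep G R) (P : {set G}) : rep G R :=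
  [ffun a => if a \in P then 0 else z a].

Lemma cosupport_cut z P : (forall a, z a != 0) -> cosupport (cut z P) = P.
Proof.
move=> z0; apply/setP => a; rewrite !inE ffunE; case: ifP => _; first exact: eqxx.
exact/negbTE.
Qed.

(** At an edge of [P] both sides are the common face product of [z] divided by [z a]; at any other
    edge both contain an edge of [P] and vanish. *)
Lemma cut_repA z P : T_Lambda z -> perfect_matching P -> in_repA (cut z P).
Proof.
move=> zL /perfect_matchingP[Pw Pb Pa]; have /T_LambdaP[z0 zF] := zL.
apply/in_repAP => a; have [aP|aP] := boolP (a \in P).
  have [aw ab] := Pa _ aP.
  have E (s : {perm G}) : alone s P a -> \prod_(b in porbit s a :\ a) cut z P b =
      (\prod_(b in porbit s a) z b) / z a.
    move=> al; rewrite [in RHS](big_setD1 a) ?porbit_id //= mulrC mulKf //.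
    apply: eq_bigr => b; rewrite !inE -eq_porbit_mem => /andP[ba /eqP bs].
    by rewrite ffunE ifN //; apply: contra ba => bP; apply/eqP/al.
  by rewrite !E // (zF _ _ (wv_face a) (bv_face a)).
have E (s : {perm G}) : (exists2 d, d \in P & porbit s d = porbit s a) ->
    \prod_(b in porbit s a :\ a) cut z P b = 0.
  case=> d dP ds; rewrite (bigD1 d) /=; first by rewrite ffunE dP mul0r.
  rewrite !inE -eq_porbit_mem ds eqxx andbT.
  by apply: contraNneq aP => <-.
by rewrite !E.
Qed.

(** On an edge of [P] the missing value is the inverse of the product of the other edges at its
    white end, which equals that at its black end by the relation; all face products become 1. *)
Lemma matching_full_rep P (y : rep G R) : perfect_matching P -> in_repA y ->
  cosupport y = P -> exists2 z, T_Lambda z & y = cut z P.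
Proof.
move=> /perfect_matchingP[Pw Pb Pa] /in_repAP yA yP.
have yP0 a : (a \in P) = (y a == 0) by rewrite -yP inE.
pose z : rep G R :=
  [ffun a => if a \in P then (\prod_(b in wv a :\ a) y b)^-1 else y a].
have E (s : {perm G}) a : a \in P -> alone s P a -> \prod_(b in porbit s a) z b =
    (\prod_(b in wv a :\ a) y b)^-1 * \prod_(b in porbit s a :\ a) y b.
  move=> aP al; rewrite (big_setD1 a) ?porbit_id //= {1}ffunE aP; congr (_ * _).
  apply: eq_bigr => b; rewrite !inE -eq_porbit_mem => /andP[ba /eqP bs].
  by rewrite ffunE ifN //; apply: contra ba => bP; apply/eqP/al.
have nz a : a \in P -> \prod_(b in wv a :\ a) y b != 0.
  move=> aP; apply/prodf_neq0 => b; rewrite !inE -eq_porbit_mem -yP0.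
  case/andP=> ba /eqP bw; apply: contra ba => bP; apply/eqP.
  by have [al _] := Pa _ aP; exact: al.
exists z; last first.
  apply/ffunP => a; rewrite !ffunE; case: ifP => aP; last by rewrite ?aP.
  by apply/eqP; rewrite -yP0.
apply/T_LambdaP; split.
  move=> a; rewrite ffunE; case: ifP => [aP|/negbT]; first by rewrite invr_eq0 nz.
  by rewrite yP0.
suff H F : is_quiver_face F -> \prod_(b in F) z b = 1 by move=> F F' HF HF'; rewrite !H.
move=> /quiver_faceP[a [->|->]].
  have [d dP <-] := Pw a; have [aw _] := Pa _ dP.
  by rewrite E // mulVf // nz.
have [d dP <-] := Pb a; have [_ ab] := Pa _ dP.
by rewrite E // -yA mulVf // nz.
Qed.

(** * Elements of [T_Lambda] along the chains *)

Section ChainProducts.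
Variables (I D : {set G}) (k : 'I_3 -> nat) (o e : 'I_3 -> nat -> G).
Hypothesis cs : chain_system I D k o e.

Section Prod.
Variable h : G -> C.
Hypothesis h1 : forall a, a \notin I -> h a = 1.

Lemma prod_sub (v A : {set G}) : A \subset v ->
  (forall c, c \in v -> c \in I -> c \in A) ->
  \prod_(a in v) h a = \prod_(a in A) h a.
Proof.
move=> Av H; rewrite (big_setID A) /= (finset.setIidPr Av) [X in _ * X]big1 ?mulr1 //.
move=> c; rewrite inE => /andP[cA cv]; apply: h1; apply: contra cA.
exact: H.
Qed.

Lemma prod_alone (s : {perm G}) c : alone s I c ->
  \prod_(a in porbit s c) h a = h c.
Proof.
move=> al; rewrite (@prod_sub _ [set c]) ?big_set1 ?finset.sub1set ?porbit_id //.
by move=> d dc dI; rewrite inE; apply/eqP/al => //; apply/eqP; rewrite eq_porbit_mem.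
Qed.

Lemma prod_pair (s : {perm G}) c d : c != d -> porbit s d = porbit s c ->
  (forall b, b \in I -> porbit s b = porbit s c -> b = c \/ b = d) ->
  \prod_(a in porbit s c) h a = h c * h d.
Proof.
move=> cd dc H; rewrite (@prod_sub _ [set c; d]).
- by rewrite big_setU1 ?inE // big_set1.
- apply/fintype.subsetP => b; rewrite !inE -eq_porbit_mem => /orP[] /eqP -> //.
  by rewrite dc.
- move=> b; rewrite -eq_porbit_mem => /eqP bc bI; rewrite !inE.
  by have [->|->] := H _ bI bc; rewrite eqxx ?orbT.
Qed.

Lemma prod_white i l : (l < k i)%N ->
  \prod_(a in wv (e i l)) h a = h (e i l) * h (o i l.+1).
Proof.
move=> Hl; apply: prod_pair; last by move=> b; exact: (cs_whiteP cs Hl).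
  by apply/eqP => /esym; apply: (cs_odd_even cs).
by rewrite (cs_white cs).
Qed.

Lemma prod_black i l : (l < k i)%N ->
  \prod_(a in bv (o i l)) h a = h (o i l) * h (e i l).
Proof.
move=> Hl; apply: prod_pair; last by move=> b; exact: (cs_blackP cs Hl).
  by apply/eqP; apply: (cs_odd_even cs) => //; apply: ltnW.
by rewrite (cs_black cs).
Qed.

Lemma prod_white_end i : \prod_(a in wv (o i 0%N)) h a = \prod_j h (o j 0%N).
Proof.
rewrite (@prod_sub _ [set o j 0%N | j : 'I_3]%SET).
- rewrite big_imset //= => j j' _ _ /(cs_odd_inj cs)[]//.
- apply/fintype.subsetP => _ /imsetP[j _ ->].
  by rewrite -eq_porbit_mem (cs_white_end cs j i).
- move=> c; rewrite -eq_porbit_mem => /eqP cw cI.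
  by have [j ->] := cs_white_endP cs cI cw; apply: imset_f.
Qed.

End Prod.

Variable P : 'I_3 -> {set G}.
Hypothesis P_sub : forall i, P i \subset I.
Hypothesis P_out : forall i c, c \in I -> c \notin D -> c \in P i.
Hypothesis P_odd : forall i j l, (l <= k j)%N -> (o j l \in P i) = (j == i).
Hypothesis P_even : forall i j l, (l < k j)%N -> (e j l \in P i) = (j != i).

Lemma lam_off s a : a \notin I -> lam P s a = 1.
Proof.
move=> aI; rewrite ffunE big1 // => i _; rewrite ifN //.
by apply: contra aI; apply: (fintype.subsetP (P_sub i)).
Qed.

(** Let [c] be the common face product. Consecutive edges of a chain multiply to [c], so the odd
    edges keep the value [s i] and the even ones have [c / s i]; single edges have value [c], and
    [c] is the product of the [s i] at the white end. *)
Lemma T_Lambda_lam t : T_Lambda t -> (forall a, a \notin I -> t a = 1) ->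
  t = lam P (fun i => t (o i 0%N)).
Proof.
move=> /T_LambdaP[t0 tF] t1; set s := fun i => _.
pose c := \prod_(j < 3) s j.
have tc F : is_quiver_face F -> \prod_(a in F) t a = c.
  by move=> HF; rewrite (tF _ _ HF (wv_face (o ord0 0%N))) prod_white_end.
have oe i l : (l < k i)%N -> t (o i l) * t (e i l) = c.
  by move=> Hl; rewrite -prod_black // tc //; exact: bv_face.
have eo i l : (l < k i)%N -> t (e i l) * t (o i l.+1) = c.
  by move=> Hl; rewrite -prod_white // tc //; exact: wv_face.
have ts i l : (l <= k i)%N -> t (o i l) = s i.
  elim: l => [//|l IHl] Hl; rewrite -IHl ?(ltnW Hl) //.
  by apply: (mulfI (t0 (e i l))); rewrite eo // mulrC oe.
apply/ffunP => a; rewrite [RHS]ffunE; have [aI|aI] := boolP (a \in I); last first.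
  by have := lam_off s aI; rewrite ffunE => ->; exact: t1.
move: a aI; apply: (chain_caseP cs) => [a aI aD|j l Hl|j l Hl].
- have [al _] := cs_alone cs aI aD.
  rewrite -(prod_alone t1 al) tc ?wv_face //; apply: eq_bigr => i _.
  by rewrite P_out.
- rewrite ts // (bigD1 j) //= P_odd // eqxx big1 ?mulr1 // => i ij.
  by rewrite P_odd // eq_sym (negPf ij).
- apply: (mulfI (t0 (o j l))); rewrite oe // ts ?(ltnW Hl) // /c (bigD1 j) //=.
  congr (_ * _); rewrite [RHS](bigD1 j) //= P_even // eqxx mul1r.
  by apply: eq_bigr => i ij; rewrite P_even // eq_sym ij.
Qed.

Lemma chain_function (T : Type) (f : G -> T) (fo fe : 'I_3 -> nat -> T) :
  exists h : G -> T, [/\ forall c, c \notin D -> h c = f c,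
    forall i l, (l <= k i)%N -> h (o i l) = fo i l
    & forall i l, (l < k i)%N -> h (e i l) = fe i l].
Proof.
have : forall c, exists y : T, [/\ c \notin D -> y = f c,
    forall i l, (l <= k i)%N -> c = o i l -> y = fo i l
    & forall i l, (l < k i)%N -> c = e i l -> y = fe i l].
  move=> c; have [cD|cD] := boolP (c \in D); last first.
    exists (f c); split => // i l Hl cE; move: cD; rewrite cE.
      by rewrite (cs_odd cs).
    by rewrite (cs_even cs).
  have [i [[l Hl ->]|[l Hl ->]]] := cs_cover cs cD.
    exists (fo i l); split=> [|i' l' Hl'|i' l' Hl'].
    - by [].
    - by move/(cs_odd_inj cs) => [] // -> ->.
    - by move/(cs_odd_even cs Hl Hl').
  exists (fe i l); split=> [|i' l' Hl'|i' l' Hl'].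
  - by [].
  - by move/esym/(cs_odd_even cs Hl' Hl).
  - by move/(cs_even_inj cs) => [] // -> ->.
move/choice => [h H]; exists h; split=> [c|i l Hl|i l Hl].
- by have [+ _ _] := H c.
- by have [_ Ho _] := H (o i l); exact: Ho.
- by have [_ _ He] := H (e i l); exact: He.
Qed.

Lemma prod_porbits (s : {perm G}) (F : G -> C) :
  \prod_a F a = \prod_(v in porbits s) \prod_(a in v) F a.
Proof.
rewrite (eq_bigl (fun a => a \in [set: G]%SET)) => [|a]; last by rewrite inE.
rewrite (partition_big_imset (porbit s)) /=.
apply: eq_big => [v|v /imsetP[a _ ->]].
  by apply/imsetP/imsetP => -[a _ ->]; exists a.
by apply: eq_bigl => b; rewrite inE eq_porbit_mem.
Qed.

(* Going along the chains from the white end determines the values on the big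
   component; at the last vertex, the black end, the product is right because
   all edges are counted once by white and once by black vertices. *)
Lemma full_rep_extension x : saturated I -> in_repA x -> cosupport x = I ->
  exists2 z, T_Lambda z & forall a, a \notin I -> z a = x a.
Proof.
move=> [Iw Ib _] /in_repAP xA xI.
(* [xt] fills the zeros of [x] with 1; a correction [h], equal to 1 outside [I], must have product
   [m v] at each vertex [v] to make all face products 1. *)
pose xt a : C := if a \in I then 1 else x a.
pose m (v : {set G}) : C := (\prod_(a in v) xt a)^-1.
have xt0 a : xt a != 0.
  by rewrite /xt; case: ifP => [_|/negbT]; [exact: oner_neq0 | rewrite -xI inE].
have m0 v : m v != 0 by rewrite invr_eq0; apply/prodf_neq0.
(* Only the product of the three first values is prescribed, so the first chain carries all of it.
   The black and white equations then give [he] and the next [ho] in turn. *)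
pose init (i : 'I_3) : C := if i == ord0 then m (wv (o ord0 0%N)) else 1.
pose ho (i : 'I_3) := nat_rect (fun=> C) (init i)
  (fun l p => m (wv (e i l)) / (m (bv (o i l)) / p)).
pose he (i : 'I_3) l := m (bv (o i l)) / ho i l.
have hoS i l : ho i l.+1 = m (wv (e i l)) / he i l by [].
have ho0 i l : ho i l != 0.
  elim: l => [|l IHl]; last by rewrite hoS /he mulf_neq0 // invr_eq0 mulf_neq0 // invr_eq0.
  by rewrite /ho /= /init; case: ifP => _; rewrite ?oner_neq0 ?m0.
have he0 i l : he i l != 0 by rewrite /he mulf_neq0 // invr_eq0.
have [h [hout hodd heven]] :=
  chain_function (fun c => if c \in I then m (wv c) else 1) ho he.
have DI := fintype.subsetP (cs_sub cs).
have h1 c : c \notin I -> h c = 1.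
  by move=> cI; rewrite hout ?(negPf cI) //; apply: contra cI; exact: DI.
have h0 c : h c != 0.
  have [cI|/h1->] := boolP (c \in I); last exact: oner_neq0.
  move: c cI; apply: (chain_caseP cs) => [c cI cD|i l Hl|i l Hl].
  - by rewrite hout // cI.
  - by rewrite hodd.
  - by rewrite heven.
pose z : rep G R := [ffun a => xt a * h a].
have zE (v : {set G}) : \prod_(a in v) h a = m v -> \prod_(a in v) z a = 1.
  move=> Hv; under eq_bigr => a _ do rewrite ffunE.
  by rewrite big_split /= Hv mulfV //; apply/prodf_neq0.
(* A single edge has to satisfy the equations at both of its ends; they agree by the relation at
   this edge. *)
have mwb c : c \in I -> c \notin D -> m (wv c) = m (bv c).
  move=> cI cD; have [aw ab] := cs_alone cs cI cD.
  have E (s : {perm G}) : alone s I c ->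
      \prod_(b in porbit s c) xt b = \prod_(b in porbit s c :\ c) x b.
    move=> al; rewrite (big_setD1 c) ?porbit_id //= {1}/xt cI mul1r.
    apply: eq_bigr => b; rewrite !inE -eq_porbit_mem => /andP[bc /eqP bs].
    by rewrite /xt ifN //; apply: contra bc => bI; apply/eqP/al.
  by rewrite /m !E // xA.
have white c : \prod_(a in wv c) z a = 1.
  have [d + <-] := Iw c; move: d.
  apply: (chain_caseP cs) => [d dI dD|i l Hl|i l Hl]; apply: zE.
  - have [al _] := cs_alone cs dI dD.
    by rewrite prod_alone // hout // dI.
  - case: l Hl => [|l] Hl.
      rewrite prod_white_end // (bigD1 ord0) //= hodd // big1 ?mulr1 => [|j j0].
        by rewrite /= /init eqxx (cs_white_end cs i ord0).
      by rewrite hodd //= /init (negPf j0).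
    by rewrite -(cs_white cs) // prod_white // heven // hodd // hoS mulrC divfK.
  - by rewrite prod_white // heven // hodd // hoS mulrC divfK.
have black c : bv c != bv (o ord0 (k ord0)) -> \prod_(a in bv c) z a = 1.
  have [d + <-] := Ib c; move: d.
  apply: (chain_caseP cs) => [d dI dD _|i l Hl nb|i l Hl _]; apply: zE.
  - have [_ al] := cs_alone cs dI dD.
    by rewrite prod_alone // hout // dI mwb.
  - have {}Hl : (l < k i)%N.
      rewrite ltn_neqAle Hl andbT; apply: contra nb => /eqP ->.
      by rewrite (cs_black_end cs i ord0).
    by rewrite prod_black // heven // hodd ?(ltnW Hl) // mulrC divfK.
  - by rewrite -(cs_black cs) // prod_black // heven // hodd ?(ltnW Hl) // mulrC divfK.
exists z => [|a aI]; last by rewrite ffunE h1 // mulr1 /xt (negPf aI).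
apply/T_LambdaP; split=> [a|]; first by rewrite ffunE mulf_neq0.
have last_black : \prod_(a in bv (o ord0 (k ord0))) z a = 1.
  have := prod_porbits (rotb G) z; rewrite (prod_porbits (rotw G)) big1.
    rewrite (bigD1 (bv (o ord0 (k ord0)))) ?imset_f //= [X in _ * X]big1 ?mulr1 //.
    by move=> v /andP[/imsetP[c _ ->]]; exact: black.
  by move=> v /imsetP[c _ ->].
suff H F : is_quiver_face F -> \prod_(b in F) z b = 1 by move=> F F' HF HF'; rewrite !H.
move=> /quiver_faceP[c [->|->]] //.
by have [->|] := eqVneq (bv c) (bv (o ord0 (k ord0))); [|exact: black].
Qed.

End ChainProducts.
End Lambda.

(** * Dimension of the orbits *)

Section Homogenization.
Variables (K : fieldType) (r : nat).

(** Homogenization of [q] in each variable separately, with [v l] as homogenizing partner of [u l].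
    The degree [msize q] bounds all exponents, so the subtraction is never truncated. *)
Definition hom_eval (q : {mpoly K[r]}) (u v : 'I_r -> K) : K :=
  \sum_(m <- msupp q) q@_m * \prod_l (u l ^+ m l * v l ^+ (msize q - m l)).

Lemma hom_eval_scale (q : {mpoly K[r]}) (chi u v : 'I_r -> K) :
  hom_eval q (fun l => chi l * u l) (fun l => chi l * v l) =
  (\prod_l chi l) ^+ msize q * hom_eval q u v.
Proof.
rewrite /hom_eval mulr_sumr; apply: eq_big_seq => m mq.
rewrite mulrCA -prodrXl -big_split /=; congr (_ * _); apply: eq_bigr => l _.
have ml : (m l <= msize q)%N.
  apply: ltnW; apply: leq_ltn_trans (msize_mdeg_lt mq).
  by rewrite mdegE (bigD1 l) //= leq_addr.
by rewrite !exprMn mulrACA -exprD subnKC.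
Qed.

Lemma hom_eval_affine (q : {mpoly K[r]}) (s v : 'I_r -> K) :
  hom_eval q (fun l => s l * v l) v = (\prod_l v l) ^+ msize q * q.@[s].
Proof.
have -> : q.@[s] = hom_eval q s (fun=> 1).
  rewrite mevalE; apply: eq_bigr => m _; congr (_ * _).
  by apply: eq_bigr => l _; rewrite expr1n mulr1.
rewrite -hom_eval_scale /hom_eval; apply: eq_bigr => m _; congr (_ * _).
by apply: eq_bigr => l _; rewrite mulr1 mulrC [s l * _]mulrC mulrC.
Qed.

End Homogenization.

Section OrbitDim.
Variables (G : brane_tiling) (R : realType).
Local Notation C := R[i].
Implicit Types x y z t : rep G R.
Variable theta : {ffun Q0 G -> int}.
Hypotheses (theta_B : in_B theta) (theta_generic : alpha_generic theta).

(** Points of a class differ by [T_B], so a zero set in [Rss] that is stable under [T_B] is the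
    preimage of a closed set of the quotient. *)
Lemma rank_invariant_closed (Q : {mpoly C[#|G|]} -> Prop) :
  (forall t y q, T_B t -> Q q -> coord_eval y q = 0 ->
     coord_eval (tmul t y) q = 0) ->
  exists2 Z, M_closed theta Z & forall y, Rss theta y ->
    (Z (git_class theta y) <-> forall q, Q q -> coord_eval y q = 0).
Proof.
move=> inv; pose V := [set y : rep G R | forall q, Q q -> coord_eval y q = 0]%classic.
pose Z := [set git_class theta y | y in Rss theta `&` V]%classic.
have ZE y : Rss theta y -> (Z (git_class theta y) <-> V y).
  move=> ys; split=> [[z [zs Vz] /(git_class_eq theta_B theta_generic zs ys)[t tB ->]]|Vy].
    by move=> q Qq; apply: inv => //; exact: Vz.
  by exists y.
exists Z => //; split; first by move=> _ [y [ys _] <-]; exists y.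
by exists V => //; exists [set q | Q q]%classic; apply/seteqP; split.
Qed.

Lemma closure_orbit_cosupport x y : Rss theta x -> Rss theta y ->
  M_closure theta (T_M_orbit (git_class theta y)) (git_class theta x) ->
  cosupport y \subset cosupport x.
Proof.
move=> xs ys cl; apply/fintype.subsetP => a aJ.
have [|Z Zcl ZE] := @rank_invariant_closed (fun q => q = mono_poly R (fun b => (b == a) : nat)).
  move=> t z q _ ->; rewrite !mono_polyE !monomial1 ffunE => ->.
  exact: mulr0.
rewrite inE -(monomial1 x a) -mono_polyE.
have : Z (git_class theta x).
  apply: cl; split => // p /(T_M_orbitP theta_B theta_generic _ ys)[t tL ->].
  apply/ZE => [|q ->]; first exact: T_Lambda_Rss.
  rewrite mono_polyE monomial1 ffunE; move: aJ; rewrite inE => /eqP ->.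
  exact: mulr0.
by move/(ZE _ xs) => -> //; rewrite eqxx.
Qed.

(** * Orbits in torus coordinates *)

Section Chart.
Variables (I : {set G}) (y : rep G R) (r : nat) (Q : 'I_r -> {set G}) (b : 'I_r -> G).
Hypotheses (ys : Rss theta y) (I_con : dual_connected I).
Hypotheses (yI : cosupport y \subset I) (Q_sub : forall l, Q l \subset I).
Hypothesis Q_perfect : forall l, perfect_matching (Q l).
Hypothesis b_support : forall l, b l \notin cosupport y.
Hypothesis b_Q : forall l l', (b l \in Q l') = (l == l').
Hypothesis lam_onto : forall t, T_Lambda t -> exists u s,
  [/\ T_B u, torus s & tmul t y = tmul u (tmul (lam Q s) y)].

Let phi (s : 'I_r -> C) := git_class theta (tmul (lam Q s) y).
Let O := T_M_orbit (git_class theta y).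

Lemma lam_Rss s : torus s -> Rss theta (tmul (lam Q s) y).
Proof. by move=> ts; apply: T_Lambda_Rss ys; exact: lam_T_Lambda. Qed.

Lemma chart_onto p : O p <-> exists2 s, torus s & p = phi s.
Proof.
rewrite /O (T_M_orbitP theta_B theta_generic _ ys); split=> [[t tL ->]|[s ts ->]].
  have [u [s [uB ts ->]]] := lam_onto tL; exists s => //.
  by rewrite git_class_tmul //; exact: lam_Rss.
by exists (lam Q s) => //; exact: lam_T_Lambda.
Qed.

Lemma chart_continuous Z : M_closed theta Z -> exists S : set {mpoly C[r]},
  forall s, torus s -> (Z (phi s) <-> forall q, S q -> q.@[s] = 0).
Proof.
case=> _ [V [S VE] ZE].
pose cf (j : 'I_#|G|) : {mpoly C[r]} := y (enum_val j) *:
  \prod_(l < r) (if enum_val j \in Q l then 'X_l else 1).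
pose pull (p : {mpoly C[#|G|]}) := p \mPo [tuple cf j | j < #|G|].
have pullE p s : (pull p).@[s] = coord_eval (tmul (lam Q s) y) p.
  rewrite comp_mpoly_meval; apply: meval_eq => j.
  rewrite tnth_mktuple mevalZ rmorph_prod /= !ffunE mulrC; congr (_ * _).
  by apply: eq_bigr => l _; case: ifP => _; rewrite ?mevalXU ?meval1.
exists [set pull p | p in S]%classic => s ts.
rewrite (ZE _ (lam_Rss ts)) VE; split=> [H _ [p Sp <-]|H p Sp].
  by rewrite pullE; exact: H.
have : (pull p).@[s] = 0 by apply: H; exists p.
by rewrite pullE.
Qed.

Lemma monomial_lam_off (s : 'I_r -> C) m : supported_off I m -> monomial (lam Q s) m = 1.
Proof.
move=> mI; rewrite /monomial big1 // => a _; have [aI|aI] := boolP (a \in I).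
  by rewrite mI // expr0.
rewrite ffunE big1 ?expr1n // => l _; rewrite ifN //.
by apply: contra aI; exact: (fintype.subsetP (Q_sub l)).
Qed.

(** The cycle through [b l] avoids [I] elsewhere, so only [b l] feels [lam Q s], and only through
    [s l]. On the orbit [s l] is thus [u z l / v z l], and [T_B] scales both terms by the same
    factor. *)
Lemma chart_closed (S : set {mpoly C[r]}) : exists2 Z, M_closed theta Z &
  forall s, torus s -> (Z (phi s) <-> forall q, S q -> q.@[s] = 0).
Proof.
have /choice[m /choice[n mn]] := fun l => arrow_cycle R (b l) I_con.
pose A l := expD (fun a => (a == b l) : nat) (m l).
have mI l : supported_off I (m l) by have [] := mn l.
have nI l : supported_off I (n l) by have [] := mn l.
have yoff p : supported_off I p -> monomial y p != 0.
  by move=> pI; apply: monomial_neq0 => a /(fintype.subsetP yI); exact: pI.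
(* The value of the cycle at [y], divided out so that [y] gets all coordinates 1. *)
pose c l := monomial y (A l) / monomial y (n l).
have c0 l : c l != 0.
  have bl : y (b l) != 0 by have := b_support l; rewrite inE.
  apply: mulf_neq0; last by rewrite invr_eq0 yoff.
  by rewrite /A monomialD monomial1; apply: mulf_neq0 => //; exact: yoff.
pose u z l := (c l)^-1 * monomial z (A l).
pose v z l := monomial z (n l) : C.
pose hat (q : {mpoly C[r]}) : {mpoly C[#|G|]} := \sum_(k <- msupp q) q@_k *:
  \prod_l (((c l)^-1 *: mono_poly R (A l)) ^+ k l * mono_poly R (n l) ^+ (msize q - k l)).
have hatE z q : coord_eval z (hat q) = hom_eval q (u z) (v z).
  rewrite /coord_eval raddf_sum; apply: eq_bigr => k _.
  rewrite /= mevalZ; congr (_ * _); rewrite rmorph_prod; apply: eq_bigr => l _.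
  by rewrite /= mevalM !rmorphXn /= mevalZ /u /v -!mono_polyE.
have [|Z Zcl ZE] := @rank_invariant_closed (fun p => exists2 q, S q & p = hat q).
  move=> t z _ /T_BP[g g0 ->] [q Sq ->]; rewrite !hatE => H.
  transitivity (hom_eval q (fun l => monomial (gauge g) (n l) * u z l)
                           (fun l => monomial (gauge g) (n l) * v z l)).
    congr (hom_eval q _ _); apply/funext => l; rewrite /u /v monomial_tmul //.
    by have [_ _ /(_ _ g0) ->] := mn l; rewrite mulrCA.
  by rewrite hom_eval_scale H mulr0.
exists Z => // s ts; rewrite (ZE _ (lam_Rss ts)).
have E q : coord_eval (tmul (lam Q s) y) (hat q) =
    (\prod_l v y l) ^+ msize q * q.@[s].
  rewrite hatE -hom_eval_affine; congr (hom_eval q _ _); apply/funext => l.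
    rewrite /u monomial_tmul {1}/A monomialD monomial1.
    rewrite (monomial_lam_off s (mI l)) mulr1 ffunE.
    rewrite (bigD1 l) //= b_Q eqxx big1 ?mulr1 => [|l' l'l].
      rewrite /v /c; field; rewrite yoff ?nI //.
      by have := c0 l; rewrite /c mulf_eq0 => /norP[].
    by rewrite b_Q eq_sym (negPf l'l).
  by rewrite /v monomial_tmul monomial_lam_off // mul1r.
have nz (q : {mpoly C[r]}) : (\prod_l v y l) ^+ msize q != 0.
  by apply: expf_neq0; apply/prodf_neq0 => l _; exact: yoff.
split=> [H q Sq|H _ [q Sq ->]]; last by rewrite E H // mulr0.
have /eqP := H _ (ex_intro2 _ _ q Sq erefl).
by rewrite E mulf_eq0 (negPf (nz q)) => /eqP.
Qed.

Lemma orbit_chain_bound n : irreducible_chain theta O n -> (n <= r)%N.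
Proof.
exact: torus_chain_length chart_onto chart_continuous chart_closed n.
Qed.

Lemma orbit_chain : irreducible_chain theta O r.
Proof.
exact: torus_chain chart_onto chart_continuous chart_closed.
Qed.

End Chart.
End OrbitDim.

(** * Orbits around a fixed point *)

Section FixedPoint.
Variables (R : realType) (G : brane_tiling) (theta : {ffun Q0 G -> int}).
Hypotheses (theta_B : in_B theta) (theta_generic : alpha_generic theta).
Variable x : rep G R.
Hypotheses (x_ss : Rss theta x) (x_fixed : T_M_fixed (git_class theta x)).
Variables (D : {set G}) (k : 'I_3 -> nat) (a : 'I_3 -> nat -> G).
Local Notation I := (cosupport x).
Hypothesis I_sat : saturated I.
Hypothesis cs :
  chain_system I D k (fun i l => a i l.*2.+1) (fun i l => a i l.*2.+2).
Local Notation P := (chain_matching I k a).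
Local Notation C := R[i].
Implicit Types y z t w : rep G R.

Let P_sub := chain_matching_sub I k a.
Let P_out := chain_matching_out cs.
Let P_odd := chain_matching_odd cs.
Let P_even := chain_matching_even cs.
Let P_perfect := chain_matching_perfect cs I_sat P_sub P_out P_odd P_even.

Lemma T_Lambda1 : T_Lambda ([ffun=> 1] : rep G R).
Proof. exact: T_B_sub_T_Lambda (@T_B1 G R). Qed.

Lemma T_M_orbit_refl y : Rss theta y ->
  T_M_orbit (git_class theta y) (git_class theta y).
Proof.
move=> ys; apply/(T_M_orbitP theta_B theta_generic _ ys).
by exists [ffun=> 1]; [exact: T_Lambda1 | rewrite tmul1].
Qed.

Lemma T_M_orbit_tmul t y : T_Lambda t -> Rss theta y ->
  T_M_orbit (git_class theta (tmul t y)) = T_M_orbit (git_class theta y).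
Proof.
move=> tL ys; have tys := T_Lambda_Rss tL ys; apply/seteqP; split=> p.
  case/(T_M_orbitP theta_B theta_generic _ tys) => u uL ->.
  apply/(T_M_orbitP theta_B theta_generic _ ys).
  by exists (tmul u t); [exact: T_Lambda_mul | rewrite tmulA].
case/(T_M_orbitP theta_B theta_generic _ ys) => u uL ->.
apply/(T_M_orbitP theta_B theta_generic _ tys).
exists (tmul u (tinv t)); first exact: T_Lambda_mul uL (T_Lambda_inv tL).
by rewrite tmulA tmulK // => b; exact: T_Lambda_neq0.
Qed.

Lemma orbit_point_cosupport y p z : Rss theta y ->
  T_M_orbit (git_class theta y) p -> p z -> cosupport z = cosupport y.
Proof.
move=> ys /(T_M_orbitP theta_B theta_generic _ ys)[t tL ->].
move/(git_classP theta_B theta_generic _ (T_Lambda_Rss tL ys)) => [u uB ->].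
by rewrite !cosupport_tmul //; exact: T_B_sub_T_Lambda.
Qed.

(* [x] being fixed, T_Lambda acts on the support of [x] through T_B. *)
Lemma T_Lambda_decomposition t : T_Lambda t ->
  exists u s, [/\ T_B u, torus s & t = tmul u (lam P s)].
Proof.
move=> tL; have /esym := x_fixed tL; rewrite M_act_git_class //.
have txs := T_Lambda_Rss tL x_ss.
case/(git_class_eq theta_B theta_generic x_ss txs) => u uB tE.
have uL := T_B_sub_T_Lambda uB.
(* [t] and [u] act alike on [x], so [t'] is 1 outside [I] and is determined by its values on the
   first edges. *)
pose t' := tmul (tinv u) t.
have t'L : T_Lambda t' by apply: T_Lambda_mul => //; exact: T_Lambda_inv.
exists u, (fun i => t' (a i 1%N)); split => //.
  by move=> i; exact: T_Lambda_neq0.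
rewrite -(T_Lambda_lam cs P_sub P_out P_odd P_even t'L).
  by apply/ffunP => b; rewrite !ffunE mulVKf // T_Lambda_neq0.
move=> b bI; rewrite !ffunE.
have : tmul t x b = tmul u x b by rewrite tE.
rewrite !ffunE; move: bI; rewrite inE => xb /(mulIf xb) ->.
by rewrite mulVf // T_Lambda_neq0.
Qed.

Section OrbitsAround.
Variable y : rep G R.
Hypotheses (ys : Rss theta y) (yI : cosupport y \subset I).
Let K := [set i | a i 1%N \notin cosupport y]%SET.

Lemma matching_in_cosupport i : i \notin K -> P i \subset cosupport y.
Proof.
rewrite inE negbK => aJ.
have Jsat : saturated (cosupport y).
  apply: cosupport_saturated; first by case: ys.
  by apply/set0Pn; exists (a i 1%N).
exact: (sat_contains_matching cs P_sub P_odd P_even Jsat yI aJ).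
Qed.

Lemma orbit_dimension :
  irreducible_chain theta (T_M_orbit (git_class theta y)) #|K| /\
  forall n, irreducible_chain theta (T_M_orbit (git_class theta y)) n ->
    (n <= #|K|)%N.
Proof.
pose kap (l : 'I_#|K|) : 'I_3 := enum_val l.
have I_con := Rss_connected theta_B theta_generic x_ss.
have b_support l : a (kap l) 1%N \notin cosupport y.
  by have := enum_valP l; rewrite inE.
have b_Q l l' : (a (kap l) 1%N \in P (kap l')) = (l == l').
  by rewrite (P_odd _ (l := 0)) // (inj_eq enum_val_inj).
have onto t : T_Lambda t -> exists u s,
    [/\ T_B u, torus s & tmul t y = tmul u (tmul (lam (fun l => P (kap l)) s) y)].
  case/T_Lambda_decomposition => u [s [uB ts ->]].
  exists u, (fun l => s (kap l)); split=> //.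
  rewrite tmulA; congr tmul; apply/ffunP => b; rewrite !ffunE.
  have [->|yb] := eqVneq (y b) 0; first by rewrite !mulr0.
  congr (_ * _).
  rewrite -(big_enum_val (fun i => if b \in P i then s i else 1)) /=.
  rewrite [RHS]big_mkcond; apply: eq_bigr => i _.
  case: ifPn => // bP; case: ifPn => // /matching_in_cosupport/fintype.subsetP/(_ _ bP).
  by rewrite inE (negPf yb).
have QS l : P (kap l) \subset I by exact: P_sub.
have QP l : perfect_matching (P (kap l)) by exact: P_perfect.
split; first exact: (orbit_chain theta_B theta_generic ys I_con yI QS QP b_support b_Q onto).
move=> n; exact: (orbit_chain_bound theta_B theta_generic ys I_con yI QS QP b_support b_Q onto).
Qed.

Lemma two_dimensional_orbit :
  has_dimension theta (T_M_orbit (git_class theta y)) 2 <->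
  exists i, cosupport y = P i.
Proof.
have [ch bd] := orbit_dimension; split=> [[c2 c3]|[i JE]].
  have K2 : #|K| = 2%N.
    have := bd _ c2; have := max_card (mem K); rewrite card_ord.
    case: (ltngtP #|K| 2) => // K3 H _.
    by case: c3; rewrite -[3%N](_ : #|K| = 3%N) //; apply/eqP; rewrite eqn_leq H.
  (* The complement of [K] records the first edges in the cosupport of [y]; with a single one,
     [sat_unique_matching] identifies the cosupport. *)
  have : #|~: K| = 1%N by have := cardsC K; rewrite K2 card_ord; lia.
  move/eqP/cards1P => [i KE].
  have KP j : (a j 1%N \in cosupport y) = (j == i).
    by have /setP/(_ j) := KE; rewrite !inE negbK.
  exists i; apply: (sat_unique_matching cs P_sub P_out P_odd P_even _ yI).
  - apply: cosupport_saturated; first by case: ys.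
    by apply/set0Pn; exists (a i 1%N); rewrite KP eqxx.
  - by rewrite KP.
  - by move=> j ji; rewrite KP.
have KE : K = ~: [set i].
  by apply/setP => j; rewrite [LHS]inE JE (P_odd _ (l := 0)) // !inE.
have K2 : #|K| = 2%N by have := cardsC1 i; rewrite KE card_ord.
by rewrite K2 in ch bd; split => // /bd.
Qed.

End OrbitsAround.

Variable z : rep G R.
Hypotheses (zL : T_Lambda z) (zx : forall b, b \notin I -> z b = x b).

Lemma cosupport_cut_matching i : cosupport (cut z (P i)) = P i.
Proof. by apply: cosupport_cut => b; exact: T_Lambda_neq0. Qed.

Lemma cut_Rss i : Rss theta (cut z (P i)).
Proof.
split; first by apply: cut_repA => //; exact: P_perfect.
case: x_ss => _; apply: semistable_cosupport.
by rewrite cosupport_cut_matching P_sub.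
Qed.

(** Both points are cuts along [P i] of elements of [T_Lambda], whose quotient carries one to the
    other. *)
Lemma orbit_of_matching y i : Rss theta y -> cosupport y = P i ->
  T_M_orbit (git_class theta y) = T_M_orbit (git_class theta (cut z (P i))).
Proof.
move=> ys yP; have [w wL yE] := matching_full_rep (P_perfect i) ys.1 yP.
have -> : y = tmul (tmul w (tinv z)) (cut z (P i)).
  rewrite yE; apply/ffunP => b; rewrite !ffunE; case: ifP => _; first by rewrite mulr0.
  by rewrite divfK // T_Lambda_neq0.
by apply: T_M_orbit_tmul (cut_Rss i); exact: T_Lambda_mul wL (T_Lambda_inv zL).
Qed.

(* The one-parameter subgroup given by the two other matchings contracts the
   point [cut z (P i)] to [x]. *)
Lemma orbit_closure_fixed_point i :
  M_closure theta (T_M_orbit (git_class theta (cut z (P i)))) (git_class theta x).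
Proof.
move=> Z [[_ [V [S VE] ZE]] OZ].
apply/(ZE x x_ss); rewrite VE => p Sp /=.
pose s (u : C) (j : 'I_3) : C := if j == i then 1 else u.
pose c (j : 'I_#|G|) : {poly C} := (cut z (P i) (enum_val j))%:P *
  \prod_l (if enum_val j \in P l then (if l == i then 1 else 'X) else 1).
have cE u j : (c j).[u] = tmul (lam P (s u)) (cut z (P i)) (enum_val j).
  rewrite hornerM hornerC horner_prod [RHS]ffunE mulrC [lam _ _ _]ffunE.
  congr (_ * _); apply: eq_bigr => l _; case: ifP => _; last by rewrite hornerC.
  by rewrite /s; case: ifP => _; rewrite ?hornerC ?hornerX.
pose q := mmap polyC c p.
have qE u : q.[u] = coord_eval (tmul (lam P (s u)) (cut z (P i))) p.
  by rewrite horner_mmap; apply: meval_eq => j; exact: cE.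
have q0 : q = 0.
  (* The subgroup gives zeros of [q] at all nonzero [u] only; the factor ['X] covers [u = 0], which
     is the value of interest. *)
  suff /eqP : 'X * q = 0 by rewrite mulf_eq0 polyX_eq0 => /eqP.
  apply: poly_all_roots => u; rewrite hornerM hornerX.
  have [->|u0] := eqVneq u 0; first by rewrite mul0r.
  have sL : T_Lambda (lam P (s u)).
    by apply: lam_T_Lambda => // j; rewrite /s; case: ifP; rewrite ?oner_neq0.
  have ss := T_Lambda_Rss sL (cut_Rss i).
  have : Z (git_class theta (tmul (lam P (s u)) (cut z (P i)))).
    apply: OZ; apply/(T_M_orbitP theta_B theta_generic _ (cut_Rss i)).
    by exists (lam P (s u)).
  by rewrite qE => /(ZE _ ss); rewrite VE => /(_ p Sp) H; rewrite [coord_eval _ _]H mulr0.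
(* In the limit the edges of the two other matchings become 0; together with those of [P i] they
   exhaust [I]. *)
have -> : x = tmul (lam P (s 0)) (cut z (P i)).
  apply/ffunP => b; rewrite !ffunE; have [bI|bI] := boolP (b \in I); last first.
    rewrite ifN; last by apply: contra bI; exact: (fintype.subsetP (P_sub i)).
    rewrite big1 ?mul1r ?zx // => l _; rewrite ifN //.
    by apply: contra bI; exact: (fintype.subsetP (P_sub l)).
  have xb : x b = 0 by apply/eqP; move: bI; rewrite inE.
  rewrite xb; case: ifPn => [_|bP]; first by rewrite mulr0.
  move: bI; rewrite {1}(chain_matching_union cs P_sub P_out P_odd P_even).
  case/bigcupP => l _ bl; rewrite (bigD1 l) //= bl /s ifN ?mul0r //.
  by apply: contraNneq bP => <-.
by have H0 := qE 0; rewrite q0 horner0 in H0; exact: esym H0.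
Qed.

End FixedPoint.

Theorem corollary4p18 (R : realType) (G : brane_tiling)
    (G_consistent : geometrically_consistent G R)
    (theta : {ffun Q0 G -> int})
    (theta_B : in_B theta) (theta_generic : alpha_generic theta)
    (x : rep G R) (x_ss : Rss theta x)
    (x_fixed : T_M_fixed (git_class theta x))
    (D : {set G}) (D_big : big_component (cosupport x) D)
    (k : 'I_3 -> nat) (a : 'I_3 -> nat -> G)
    (a_chains : connecting_chains D k a) :
  [/\ exists O : 'I_3 -> set (set (rep G R)),
        [/\ injective O,
            forall O', (exists i, O' = O i) <->
              [/\ is_T_M_orbit theta O', has_dimension theta O' 2
                & M_closure theta O' (git_class theta x)]
          & forall i,
              orbit_cosupport (O i) (chain_matching (cosupport x) k a i)],
      forall i, perfect_matching (chain_matching (cosupport x) k a i),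
      forall P : {set G}, P \subset cosupport x -> perfect_matching P ->
        exists i, P = chain_matching (cosupport x) k a i
    & cosupport x = \bigcup_i chain_matching (cosupport x) k a i].
Proof.
have I0 : cosupport x != finset.set0.
  by have [[c cI _] _] := D_big; apply/set0Pn; exists c.
have I_sat := cosupport_saturated x_ss.1 I0.
have I_con := Rss_connected theta_B theta_generic x_ss.
have cs := connecting_chain_system I_sat I_con D_big a_chains.
have P_sub := chain_matching_sub (cosupport x) k a.
have P_out := chain_matching_out cs.
have P_odd := chain_matching_odd cs.
have P_even := chain_matching_even cs.
have P_perfect := chain_matching_perfect cs I_sat P_sub P_out P_odd P_even.
split=> //; last first.
- by have U := chain_matching_union cs P_sub P_out P_odd P_even.
- by move=> Q; have H := @perfect_matching_chain _ _ _ _ _ _ cs _ P_sub P_out P_odd P_even Q.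
have [z zL zx] := full_rep_extension cs I_sat x_ss.1 erefl.
pose y i := cut z (chain_matching (cosupport x) k a i).
have ys i : Rss theta (y i) := cut_Rss x_ss I_sat cs zL i.
have yP i : cosupport (y i) = chain_matching (cosupport x) k a i.
  exact: cosupport_cut_matching zL i.
pose O i := T_M_orbit (git_class theta (y i)).
have Ocos i : orbit_cosupport (O i) (chain_matching (cosupport x) k a i).
  move=> p w Op pw; rewrite -yP.
  exact: (orbit_point_cosupport theta_B theta_generic (ys i) Op pw).
exists O; split=> // [i j Oij|O'].
  have Oi := T_M_orbit_refl theta_B theta_generic (ys i).
  have yi : git_class theta (y i) (y i).
    by apply/(git_classP theta_B theta_generic _ (ys i)); exists [ffun=> 1];
      [exact: T_B1 | rewrite tmul1].
  have Oj : O j (git_class theta (y i)) by rewrite -Oij.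
  (* The first edge of the chain [i] lies in no other matching, so equal orbits, having equal
     cosupports, have equal indices. *)
  have := P_odd i i 0%N (leq0n _).
  by rewrite -(Ocos i _ _ Oi yi) (Ocos j _ _ Oj yi) (P_odd j i 0%N) // eqxx => /eqP.
split=> [[i ->]|[[p [w ws <-] ->] dim2 cl]].
  split; first by exists (git_class theta (y i)) => //; exists (y i).
    apply/(two_dimensional_orbit theta_B theta_generic x_ss x_fixed I_sat cs) => //.
      by rewrite yP.
    by exists i.
  have contract := orbit_closure_fixed_point theta_B theta_generic x_ss I_sat cs zL zx.
  exact: contract.
have wI := closure_orbit_cosupport theta_B theta_generic x_ss ws cl.
have [i wP] := (two_dimensional_orbit theta_B theta_generic x_ss x_fixed I_sat cs ws wI).1 dim2.
exists i; exact: (orbit_of_matching theta_B theta_generic x_ss I_sat cs zL ws wP).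
Qed.
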